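(* Let $X$ be an infinite-dimensional complex Banach space, let $T\in L(X)$ and let $\sigma_*\in\{\sigma_{TUD},\sigma_{q\Phi},\sigma_{Kt},\sigma_{B\Phi},\sigma_{B\mathcal{W}},\sigma_{LD}^e,\sigma_{B\mathcal{W}_+},\sigma_{LD},\sigma_{RD}^e,\sigma_{B\mathcal{W}_-},\sigma_{RD},\sigma_{dsc}^e,\sigma_{dsc}\}$. If $\mathbb{C}\setminus\sigma_*(T)$ has only one component, then $\sigma_*(T)=\sigma_D(T)$.
   Context: $L(X)$ is the algebra of bounded linear operators on $X$; $N(T)$, $R(T)$ are the null space and range; $\alpha(T)=\dim N(T)$, $\beta(T)=\operatorname{codim}R(T)$; $\mathbb{N}_0=\{0,1,2,\dots\}$; $\inf\emptyset=\infty$. ''Component'' means connected component. Ascent $a(T)=\inf\{n\in\mathbb{N}_0:N(T^n)=N(T^{n+1})\}$; descent $\delta(T)=\inf\{n\in\mathbb{N}_0:R(T^n)=R(T^{n+1})\}$; essential ascent $a_e(T)=\inf\{n\in\mathbb{N}_0:\dim N(T^{n+1})/N(T^n)<\infty\}$; essential descent $\delta_e(T)=\inf\{n\in\mathbb{N}_0:\dim R(T^n)/R(T^{n+1})<\infty\}$. $T$ is left Drazin invertible if $a(T)<\infty$ and $R(T^{a(T)+1})$ is closed; right Drazin invertible if $\delta(T)<\infty$ and $R(T^{\delta(T)})$ is closed; Drazin invertible if $a(T)<\infty$ and $\delta(T)<\infty$; left essentially Drazin invertible if $a_e(T)<\infty$ and $R(T^{a_e(T)+1})$ is closed; right essentially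 Drazin invertible if $\delta_e(T)<\infty$ and $R(T^{\delta_e(T)})$ is closed. The corresponding spectra (sets of $\lambda\in\mathbb{C}$ for which $T-\lambda I$ fails the property) are $\sigma_{LD}(T),\sigma_{RD}(T),\sigma_D(T),\sigma_{LD}^e(T),\sigma_{RD}^e(T)$. Also $\sigma_{dsc}(T)=\{\lambda:\delta(T-\lambda I)=\infty\}$, $\sigma_{dsc}^e(T)=\{\lambda:\delta_e(T-\lambda I)=\infty\}$. An operator $S$ on a complex Banach space is upper semi-Fredholm if $\alpha(S)<\infty$ and $R(S)$ is closed, lower semi-Fredholm if $\beta(S)<\infty$, Fredholm if both; $\operatorname{ind}(S)=\alpha(S)-\beta(S)$. Let $T_n$ be the restriction of $T$ to $R(T^n)$ as a map $R(T^n)\to R(T^n)$. $T$ is B-Fredholm (resp. upper, lower semi-B-Fredholm) if for some $n\in\mathbb{N}_0$, $R(T^n)$ is closed and $T_n$ is Fredholm (resp. upper, lower semi-Fredholm); then $\operatorname{ind}(T):=\operatorname{ind}(T_n)$, independent of such $n$. $T$ is B-Weyl if it is B-Fredholm with $\operatorname{ind}(T)=0$; upper semi-B-Weyl if upper semi-B-Fredholm with $\operatorname{ind}(T)\le0$; lower semi-B-Weyl if lower semi-B-Fredholm with $\operatorname{ind}(T)\ge0$. The spectra for B-Fredholm, B-Weyl, upper semi-B-Weyl, lower semi-B-Weyl operators are $\sigma_{B\Phi}(T),\sigma_{B\mathcal{W}}(T),\sigma_{B\mathcal{W}_+}(T),\sigma_{B\mathcal{W}_-}(T)$. $T$ is Kato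 if $R(T)$ is closed and $N(T)\subset R(T^n)$ for every $n\in\mathbb{N}$; $T$ is of Kato type if there are closed $T$-invariant subspaces $X_1,X_2$ with $X=X_1\oplus X_2$, $T|_{X_1}$ nilpotent and $T|_{X_2}$ Kato. Let $k_n(T)=\dim (R(T^n)\cap N(T))/(R(T^{n+1})\cap N(T))$. $T$ is quasi-Fredholm if there is $d\in\mathbb{N}_0$ with $k_n(T)=0$ for all $n\ge d$ and $R(T^{d+1})$ closed. $T$ has topological uniform descent (TUD) if there is $d\in\mathbb{N}_0$ with $k_n(T)=0$ for all $n\ge d$ and, for all $n\ge d$, $R(T^n)$ closed in $R(T^d)$ with respect to the norm $\|y\|_d=\inf\{\|x\|:x\in X,\ y=T^dx\}$. The sets of $\lambda$ for which $T-\lambda I$ is not of Kato type, is not quasi-Fredholm, does not have TUD are $\sigma_{Kt}(T),\sigma_{q\Phi}(T),\sigma_{TUD}(T)$. *)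

(* Defs.v *)
From mathcomp Require Import all_boot all_order all_algebra.
From mathcomp Require Import complex.
From mathcomp Require Import all_classical all_reals all_analysis.

Set Implicit Arguments.
Unset Strict Implicit.
Unset Printing Implicit Defensive.

Import Order.TTheory GRing.Theory Num.Theory.
Import numFieldTopology.Exports numFieldNormedType.Exports.

Local Open Scope classical_set_scope.
Local Open Scope ring_scope.
Local Open Scope complex_scope.

(* Dimensions, ascents, descents and indices live in \bar R, so that they may
   be infinite; [ereal_inf set0 = +oo]. *)
Definition inf_nat (R : realType) (A : set nat) : \bar R :=
  ereal_inf [set (n%:R)%:E | n in A].

Section Operators.
Context (R : realType) (X : completeNormedModType R[i]).
Implicit Types (S T : X -> X) (A M N : set X) (n d : nat).

Definition linear_subspace M :=
  M 0 /\ forall (a : R[i]) x y, M x -> M y -> M (a *: x + y).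

(* [e] is a family in M whose classes form a basis of the quotient M / N. *)
Definition basis_mod M N n (e : 'I_n -> X) :=
  [/\ forall i, M (e i),
      forall c : 'I_n -> R[i], N (\sum_i c i *: e i) -> forall i, c i = 0
    & forall x, M x -> exists c : 'I_n -> R[i], N (x - \sum_i c i *: e i)].

(* dim (M / N), for linear subspaces N `<=` M. *)
Definition qdim M N : \bar R :=
  inf_nat R [set n | exists e : 'I_n -> X, basis_mod M N e].

Definition null_space S : set X := S @^-1` [set 0].

Definition ascent S : \bar R :=
  inf_nat R [set n | null_space (iter n S) = null_space (iter n.+1 S)].

Definition descent S : \bar R :=
  inf_nat R [set n | range (iter n S) = range (iter n.+1 S)].

Definition ess_ascent S : \bar R :=
  inf_nat R [set n |
    (qdim (null_space (iter n.+1 S)) (null_space (iter n S)) < +oo)%E].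

Definition ess_descent S : \bar R :=
  inf_nat R [set n |
    (qdim (range (iter n S)) (range (iter n.+1 S)) < +oo)%E].

Definition left_Drazin S :=
  exists p : nat, ascent S = (p%:R)%:E /\ closed (range (iter p.+1 S)).

Definition right_Drazin S :=
  exists q : nat, descent S = (q%:R)%:E /\ closed (range (iter q S)).

Definition Drazin S := (ascent S < +oo)%E /\ (descent S < +oo)%E.

Definition left_ess_Drazin S :=
  exists p : nat, ess_ascent S = (p%:R)%:E /\ closed (range (iter p.+1 S)).

Definition right_ess_Drazin S :=
  exists q : nat, ess_descent S = (q%:R)%:E /\ closed (range (iter q S)).

Definition fin_descent S := (descent S < +oo)%E.

Definition fin_ess_descent S := (ess_descent S < +oo)%E.

(* The suffix _on refers to the restriction of S to an S-invariant subspace M,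
   seen as an operator on M. *)
Definition alpha_on M S : \bar R := qdim (M `&` null_space S) [set 0].

Definition beta_on M S : \bar R := qdim M (S @` M).

Definition closed_range_on M S := closed (S @` M : set (subspace M)).

Definition upper_semi_Fredholm_on M S :=
  (alpha_on M S < +oo)%E /\ closed_range_on M S.

Definition lower_semi_Fredholm_on M S := (beta_on M S < +oo)%E.

Definition Fredholm_on M S :=
  upper_semi_Fredholm_on M S /\ lower_semi_Fredholm_on M S.

Definition index_on M S : \bar R := (alpha_on M S - beta_on M S)%E.

Definition B_Fredholm S := exists n,
  closed (range (iter n S)) /\ Fredholm_on (range (iter n S)) S.

Definition upper_semi_B_Fredholm S := exists n,
  closed (range (iter n S)) /\ upper_semi_Fredholm_on (range (iter n S)) S.

Definition lower_semi_B_Fredholm S := exists n,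
  closed (range (iter n S)) /\ lower_semi_Fredholm_on (range (iter n S)) S.

(* The index of a semi-B-Fredholm operator does not depend on the choice of n;
   it is a dummy value if S is not semi-B-Fredholm. *)
Definition B_index S : \bar R :=
  let n := xget 0%N [set n | closed (range (iter n S)) /\
    (upper_semi_Fredholm_on (range (iter n S)) S \/
     lower_semi_Fredholm_on (range (iter n S)) S)] in
  index_on (range (iter n S)) S.

Definition B_Weyl S := B_Fredholm S /\ B_index S = 0%E.

Definition upper_semi_B_Weyl S :=
  upper_semi_B_Fredholm S /\ (B_index S <= 0)%E.

Definition lower_semi_B_Weyl S :=
  lower_semi_B_Fredholm S /\ (0 <= B_index S)%E.

Definition Kato_on M S :=
  closed_range_on M S /\
  forall n, (0 < n)%N -> M `&` null_space S `<=` iter n S @` M.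

Definition Kato_type S := exists X1 X2 : set X,
  [/\ [/\ linear_subspace X1, closed X1 & S @` X1 `<=` X1],
      [/\ linear_subspace X2, closed X2 & S @` X2 `<=` X2],
      (forall x, exists x1 x2, [/\ X1 x1, X2 x2 & x = x1 + x2]) /\
        X1 `&` X2 = [set 0],
      exists n, forall x, X1 x -> iter n S x = 0
    & Kato_on X2 S].

Definition k_ n S : \bar R :=
  qdim (range (iter n S) `&` null_space S)
       (range (iter n.+1 S) `&` null_space S).

Definition quasi_Fredholm S := exists d,
  (forall n, (d <= n)%N -> k_ n S = 0%E) /\ closed (range (iter d.+1 S)).

(* The norm of X takes values in R[i], hence the real part. *)
Definition range_norm d S (y : X) : R :=
  inf [set complex.Re `|x| | x in [set x | y = iter d S x]].

(* A is closed in range (iter d S) for the norm [range_norm d S]. *)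
Definition range_norm_closed d S A :=
  forall y, range (iter d S) y ->
    (forall e : R, 0 < e -> exists2 z, A z & range_norm d S (y - z) < e) -> A y.

Definition TUD S := exists d,
  (forall n, (d <= n)%N -> k_ n S = 0%E) /\
  (forall n, (d <= n)%N -> range_norm_closed d S (range (iter n S))).

Definition spectrum (P : (X -> X) -> Prop) T : set R[i] :=
  [set l | ~ P (fun x => T x - l *: x)].

Definition sigma_TUD := spectrum TUD.
Definition sigma_qPhi := spectrum quasi_Fredholm.
Definition sigma_Kt := spectrum Kato_type.
Definition sigma_BPhi := spectrum B_Fredholm.
Definition sigma_BW := spectrum B_Weyl.
Definition sigma_BWp := spectrum upper_semi_B_Weyl.
Definition sigma_BWm := spectrum lower_semi_B_Weyl.
Definition sigma_LD := spectrum left_Drazin.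
Definition sigma_RD := spectrum right_Drazin.
Definition sigma_LDe := spectrum left_ess_Drazin.
Definition sigma_RDe := spectrum right_ess_Drazin.
Definition sigma_D := spectrum Drazin.
Definition sigma_dsc := spectrum fin_descent.
Definition sigma_dsce := spectrum fin_ess_descent.

Definition infinite_dimensional := qdim [set: X] [set 0] = +oo%E.

End Operators.

Arguments infinite_dimensional {R} X.

Definition one_component (Y : topologicalType) (A : set Y) :=
  exists C : set Y, connected_component A @` A = [set C].

(* Main.v *)
Require Import Defs.
From HB Require Import structures.
From mathcomp Require Import all_boot all_order all_algebra.
From mathcomp Require Import complex.
From mathcomp Require Import all_classical all_reals all_analysis.
From mathcomp Require Import ring lra zify.

(** Write S for T - l. Each of the thirteen classes contains the Drazin
    invertible operators, so sigma T is contained in sigma_D T, and the point is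
    the converse inclusion.

    The property that all classes share is regular descent: for some d, the
    operator induced by S on R(S^d), with the norm that makes R(S^d) a copy of
    the Banach space X / N(S^d), is a Kato operator (closed range, and kernel
    contained in the range of every power). If such an S is moreover a limit of
    invertible operators S - m with m <> 0, then the induced operator is
    bijective: a kernel vector could be continued to an eigenvector of S for
    every small m, by a geometric series of iterated preimages
    ([regular_descent_null]); and an injective operator with closed range that is
    a limit of surjective ones is surjective ([regular_descent_range]).
    Bijectivity on R(S^d) says that ascent and descent are at most d, so S is
    Drazin invertible ([Drazin_of_limit]).

    Conversely, if S is Drazin invertible, then X = N(S^p) + R(S^p) is a direct
    sum of closed subspaces, S is nilpotent on the first and bijective on the
    second, hence S - m is invertible for all small m <> 0
    ([Drazin_punctured]).

    Let Omega be the complement of sigma T and V the set of the l for which T - l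
    is a limit of invertible operators T - l - m, m <> 0. V is closed, by
    a diagonal argument; by the first result the operators T - l with l in Omega and V are
    Drazin invertible, and by the second V is a neighbourhood of every such l. So
    the trace of V on Omega is relatively open and closed. It is not empty, as
    T - l is invertible for large l, and Omega is connected, so Omega is contained
    in V, and T - l is Drazin invertible for all l in Omega
    ([spectrum_eq_Drazin]).

    Regular descent is part of the definition for uniform descent and
    quasi-Fredholm operators, and for operators of Kato type it follows from the
    boundedness of the projections. For the other classes it rests on finiteness.
    If R(S^q) / R(S^(q+1)) is finite-dimensional, or if N(S^(p+1)) / N(S^p) is and
    R(S^(p+1)) is closed, then the chain R(S) + N(S^n), resp. N(S) & R(S^n), is
    eventually constant, and the required range is closed because finite
    extensions of closed subspaces, and operator ranges of finite codimension, are
    ([finite_range_quotient_regular], [finite_null_quotient_regular]). That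
    Drazin invertible operators have B-index 0 holds because the nullity and the
    defect of S on R(S^n) satisfy the same recursion in n
    ([null_range_defect_step]).

    All topological steps use one form of the open mapping theorem, for closed
    linear relations between Banach spaces ([open_mapping]); this avoids quotient
    spaces and spaces of the form R(S^d) with their own norm. *)

Set Implicit Arguments.
Unset Strict Implicit.
Unset Printing Implicit Defensive.

Import Order.TTheory GRing.Theory Num.Theory.
Import numFieldTopology.Exports numFieldNormedType.Exports.

Local Open Scope classical_set_scope.
Local Open Scope ring_scope.
Local Open Scope complex_scope.

(** * Real-valued norm and completeness *)

Section RealNorm.
Context {R : realType}.
Implicit Types (V W : normedModType R[i]) (e K : R).

(** The norm of a module over R[i] has values in the partially ordered R[i]; its
    real part carries the same information and has totally ordered values. *)
Definition nrm V (x : V) : R := complex.Re `|x|.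

Lemma nrmE V (x : V) : `|x| = (nrm x)%:C.
Proof. by rewrite /nrm RRe_real // ger0_real. Qed.

Lemma nrm_ge0 V (x : V) : 0 <= nrm x.
Proof. by rewrite -ler0c -nrmE. Qed.

Lemma nrm0 V : nrm (0 : V) = 0.
Proof. by rewrite /nrm normr0. Qed.

Lemma nrm_eq0 V (x : V) : nrm x = 0 -> x = 0.
Proof. by move=> x0; apply/eqP; rewrite -normr_eq0 nrmE x0. Qed.

Lemma nrm_gt0 V (x : V) : x != 0 -> 0 < nrm x.
Proof. by move=> x0; rewrite -ltcR -nrmE normr_gt0. Qed.

Lemma nrmD V (x y : V) : nrm (x + y) <= nrm x + nrm y.
Proof. by rewrite -lecR rmorphD /= -!nrmE ler_normD. Qed.

Lemma nrmN V (x : V) : nrm (- x) = nrm x.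
Proof. by rewrite /nrm normrN. Qed.

Lemma nrmB V (x y : V) : nrm (x - y) <= nrm x + nrm y.
Proof. by rewrite -(nrmN y) nrmD. Qed.

Lemma nrm_distC V (x y : V) : nrm (x - y) = nrm (y - x).
Proof. by rewrite -nrmN opprB. Qed.

Lemma nrm_tri V (z x y : V) : nrm (x - y) <= nrm (x - z) + nrm (z - y).
Proof. by rewrite -{1}(subrK z x) -addrA nrmD. Qed.

Lemma nrm_le_dist V (x y : V) : nrm x <= nrm (x - y) + nrm y.
Proof. by rewrite -{1}(subrK y x) nrmD. Qed.

Lemma nrmZ V (a : R[i]) (x : V) : nrm (a *: x) = nrm (a : R[i]^o) * nrm x.
Proof. by apply: complexI; rewrite rmorphM /= -!nrmE normrZ. Qed.

Lemma nrm_real e : 0 <= e -> nrm (e%:C : R[i]^o) = e.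
Proof. by move=> e0; rewrite /nrm ger0_norm // ler0c. Qed.

Lemma nrmZr V e (x : V) : 0 <= e -> nrm (e%:C *: x) = e * nrm x.
Proof. by move=> e0; rewrite nrmZ nrm_real. Qed.

Lemma nrm_pair_lt V W (x : V) (y : W) e :
  (nrm ((x, y) : V * W) < e) = (nrm x < e) && (nrm y < e).
Proof.
by rewrite -!ltcR -!nrmE prod_normE comparable_gt_max // real_comparable.
Qed.

Lemma nrm_pair_le V W (x : V) (y : W) e :
  (nrm ((x, y) : V * W) <= e) = (nrm x <= e) && (nrm y <= e).
Proof.
by rewrite -!lecR -!nrmE prod_normE comparable_ge_max // real_comparable.
Qed.

Definition adherent V (A : set V) x :=
  forall e, 0 < e -> exists2 y, A y & nrm (x - y) < e.

Lemma nrm_ball V (x y : V) e : ball x e%:C y <-> nrm (x - y) < e.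
Proof. by rewrite -ball_normE /= nrmE ltcR. Qed.

Lemma complex_gt0 (e : R[i]) : 0 < e -> exists2 d, 0 < d & e = d%:C.
Proof.
move=> e0; exists (complex.Re e); last by rewrite RRe_real // gtr0_real.
by rewrite -(ltcR 0) RRe_real // gtr0_real.
Qed.

Lemma nbhs_nrm V (x : V) (A : set V) :
  nbhs x A <-> exists2 e, 0 < e & forall y, nrm (x - y) < e -> A y.
Proof.
split=> [/nbhs_ballP [e /complex_gt0[d d0 ->] dA] | [e e0 eA]].
  by exists d => // y xy; apply/dA/nrm_ball.
by apply/nbhs_ballP; exists e%:C; [rewrite /= (ltcR 0) | move=> y /nrm_ball/eA].
Qed.

Lemma closed_adherent V (A : set V) x : closed A -> adherent A x -> A x.
Proof.
move=> cA adA; apply: cA => B /nbhs_nrm [e e0 eB].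
by have [y Ay xy] := adA _ e0; exists y; split => //; apply: eB.
Qed.

Lemma adherent_closed V (A : set V) :
  (forall x, adherent A x -> A x) -> closed A.
Proof.
move=> adA x clA; apply: adA => e e0.
have /clA[y [Ay xy]] : nbhs x [set y | nrm (x - y) < e].
  by apply/nbhs_nrm; exists e.
by exists y.
Qed.

Lemma continuous_nrm V W (f : {linear V -> W}) : continuous f ->
  exists2 C : R, 0 < C & forall x, nrm (f x) <= C * nrm x.
Proof.
move=> /linear_bounded_continuous /linear_boundedP.
move=> /pinfty_ex_gt0[r /complex_gt0[C C0 ->] rf].
by exists C => // x; rewrite -lecR rmorphM /= -!nrmE.
Qed.

Lemma pow_half_small K e : 0 < e ->
  exists N, forall n, (N <= n)%N -> K / 2 ^+ n < e.
Proof.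
move=> e0; exists (Num.bound (K / e)) => n Nn.
have [K0|K0] := ltP K 0.
  by apply: lt_trans e0; rewrite pmulr_llt0 // invr_gt0 exprn_gt0.
rewrite ltr_pdivrMr ?exprn_gt0 // -ltr_pdivrMl // mulrC.
apply: lt_le_trans (archi_boundP _) _; first by rewrite divr_ge0 // ltW.
by rewrite -natrX ler_nat (leq_trans Nn) // ltnW // ltn_expl.
Qed.


(** Completeness for series dominated by a geometric one, with an explicit rate.
    Geometric series are the only ones that arise from Baire's theorem, open
    mapping and perturbation, and in this form completeness passes to products. *)
Definition series_complete V := forall (z : nat -> V) K,
  (forall k, nrm (z k) <= K / 2 ^+ k) ->
  exists l, forall n, nrm (l - \sum_(k < n) z k) <= 2 * K / 2 ^+ n.

Lemma nrm_sum_tail V (z : nat -> V) K :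
  (forall k, nrm (z k) <= K / 2 ^+ k) ->
  forall n m, (n <= m)%N ->
    nrm (\sum_(k < m) z k - \sum_(k < n) z k) <= 2 * K / 2 ^+ n.
Proof.
move=> zK n m /subnK <-; have K0 : 0 <= K.
  by have := le_trans (nrm_ge0 _) (zK 0%N); rewrite expr0 divr1.
suff : nrm (\sum_(k < m - n + n) z k - \sum_(k < n) z k) <=
    2 * K / 2 ^+ n - 2 * K / 2 ^+ (m - n + n).
  by move/le_trans; apply; rewrite gerBl mulr_ge0 ?invr_ge0 ?exprn_ge0 ?mulr_ge0.
elim: (m - n)%N => [|j IH]; first by rewrite !subrr nrm0.
rewrite addSn big_ord_recr /= addrAC.
apply: le_trans (nrmD _ _) _.
have := zK (j + n)%N; rewrite exprS invfM.
move: IH; set A := _ ^-1; set B := (2 ^+ _)^-1; lra.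
Qed.

Lemma series_tail_limit V (z : nat -> V) K l :
  (forall k, nrm (z k) <= K / 2 ^+ k) ->
  (forall e, 0 < e ->
     exists N, forall n, (N <= n)%N -> nrm (l - \sum_(k < n) z k) <= e) ->
  forall n, nrm (l - \sum_(k < n) z k) <= 2 * K / 2 ^+ n.
Proof.
move=> zK zl n; apply/ler_addgt0Pl => e /zl[N Nl].
apply: le_trans (nrm_tri (\sum_(k < maxn N n) z k) _ _) _.
apply: lerD; first by apply: Nl; exact: leq_maxl.
by apply: nrm_sum_tail => //; exact: leq_maxr.
Qed.

Lemma complete_series_complete (V : completeNormedModType R[i]) :
  series_complete V.
Proof.
move=> z K zK; pose s n := \sum_(k < n) z k.
have tail := nrm_sum_tail zK.
have /cauchy_cvgP/cvg_ex[l sl] : cauchy (s @ \oo).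
  apply/cauchy_ballP => e /complex_gt0[d d0 ->].
  have [N NK] := @pow_half_small (2 * (2 * K)) _ d0.
  have near_s : (s @ \oo) [set y | nrm (s N - y) < d / 2].
    exists N => // n Nn /=; rewrite nrm_distC.
    apply: le_lt_trans (tail _ _ Nn) _.
    by have := NK N (leqnn _); set A := _ ^-1; lra.
  exists ([set y | nrm (s N - y) < d / 2], [set y | nrm (s N - y) < d / 2]).
    by split.
  move=> [x y] /= [xN yN]; apply/nrm_ball.
  apply: le_lt_trans (nrm_tri (s N) _ _) _; rewrite nrm_distC; lra.
exists l; apply: series_tail_limit => // e e0.
have : (s @ \oo) [set y | nrm (l - y) < e].
  by apply: sl; apply/nbhs_nrm; exists e.
by move=> [N _ Ns]; exists N => n /Ns /ltW.
Qed.

Lemma pair_series_complete V W :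
  series_complete V -> series_complete W -> series_complete (V * W)%type.
Proof.
move=> cV cW z K zK.
have zV k : nrm (z k).1 <= K / 2 ^+ k.
  by move: (zK k); rewrite [z k]surjective_pairing nrm_pair_le => /andP[].
have zW k : nrm (z k).2 <= K / 2 ^+ k.
  by move: (zK k); rewrite [z k]surjective_pairing nrm_pair_le => /andP[].
have [l1 l1P] := cV _ _ zV; have [l2 l2P] := cW _ _ zW.
exists (l1, l2) => n.
have -> : \sum_(k < n) z k = (\sum_(k < n) (z k).1, \sum_(k < n) (z k).2).
  elim: n => [|n IH]; first by rewrite !big_ord0.
  by rewrite !big_ord_recr /= IH [z n]surjective_pairing.
by rewrite nrm_pair_le l1P l2P.
Qed.
(** The limit is the supremum of the lower bounds s_n - 2K/2^n, where the s_n are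
    the partial sums: these increase, while the upper bounds s_n + 2K/2^n
    decrease. *)
Lemma real_series_limit (u : nat -> R) K :
  (forall k, `|u k| <= K / 2 ^+ k) ->
  exists l, forall n, `|l - \sum_(k < n) u k| <= 2 * K / 2 ^+ n.
Proof.
move=> uK; pose s n := \sum_(k < n) u k; pose r n := 2 * K / 2 ^+ n.
have step n : s n - r n <= s n.+1 - r n.+1 /\ s n.+1 + r n.+1 <= s n + r n.
  rewrite /s /r big_ord_recr /= exprS invfM; have := uK n; rewrite ler_norml.
  by move=> /andP[]; set A := (2 ^+ n)^-1; lra.
have lo m n : s m - r m <= s (m + n)%N - r (m + n)%N.
  elim: n => [|n IH]; first by rewrite addn0.
  by apply: le_trans IH _; rewrite addnS; exact: (step _).1.
have up m n : s (m + n)%N + r (m + n)%N <= s m + r m.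
  elim: n => [|n IH]; first by rewrite addn0.
  by apply: le_trans IH; rewrite addnS; exact: (step _).2.
have r0 n : 0 <= r n.
  have K0 : 0 <= K by have := le_trans (normr_ge0 _) (uK 0%N); rewrite expr0 divr1.
  by rewrite /r mulr_ge0 ?mulr_ge0 // invr_ge0 exprn_ge0.
have lu m n : s m - r m <= s n + r n.
  apply: le_trans (lo m n) _; rewrite addnC.
  by apply: le_trans (up n m); have := r0 (n + m)%N; lra.
pose A := range (fun n => s n - r n).
have A0 : A !=set0 by exists (s 0%N - r 0%N), 0%N.
exists (sup A) => n; rewrite ler_norml; apply/andP; split.
  suff : s n - r n <= sup A by rewrite /s /r; lra.
  apply: ub_le_sup; last by exists n.
  by exists (s 0%N + r 0%N) => _ [m _ <-].
suff : sup A <= s n + r n by rewrite /s /r; lra.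
by apply: ge_sup => // _ [m _ <-].
Qed.

Lemma complex_norm_le (z : R[i]) :
  [/\ `|complex.Re z| <= nrm (z : R[i]^o), `|complex.Im z| <= nrm (z : R[i]^o)
    & nrm (z : R[i]^o) <= `|complex.Re z| + `|complex.Im z|].
Proof.
rewrite /nrm normc_def /=; set a := complex.Re z; set b := complex.Im z.
split.
- by rewrite -sqrtr_sqr ler_wsqrtr // lerDl sqr_ge0.
- by rewrite -sqrtr_sqr ler_wsqrtr // lerDr sqr_ge0.
rewrite -[leRHS]ger0_norm ?addr_ge0 // -sqrtr_sqr ler_wsqrtr //.
rewrite sqrrD !real_normK ?num_real // -addrA lerD2l lerDr.
by rewrite mulrn_wge0 // mulr_ge0.
Qed.

Lemma scalar_series_complete : series_complete R[i]^o.
Proof.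
move=> z K zK.
have [a aP] := @real_series_limit (fun k => complex.Re (z k)) K
  (fun k => le_trans (let: And3 p _ _ := complex_norm_le (z k) in p) (zK k)).
have [b bP] := @real_series_limit (fun k => complex.Im (z k)) K
  (fun k => le_trans (let: And3 _ p _ := complex_norm_le (z k) in p) (zK k)).
exists (a +i* b); apply: series_tail_limit => // e e0.
have [N NK] := pow_half_small (4 * K) e0; exists N => n /NK Ke.
case: (complex_norm_le (a +i* b - \sum_(k < n) z k)) => _ _ /le_trans; apply.
have -> : \sum_(k < n) z k =
    (\sum_(k < n) complex.Re (z k)) +i* (\sum_(k < n) complex.Im (z k)).
  elim: (n) => [|m IH]; first by rewrite !big_ord0.
  by rewrite !big_ord_recr /= IH; case: (z m).
have := aP n; have := bP n; move: Ke => /=; set A := (2 ^+ n)^-1; lra.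
Qed.

End RealNorm.

(** * Linear subspaces *)

Section Subspaces.
Context {R : realType}.

Definition is_subspace (V : lmodType R[i]) (A : set V) :=
  A 0 /\ forall (a : R[i]) x y, A x -> A y -> A (a *: x + y).

Section Closure.
Context {V : lmodType R[i]} {A : set V}.
Hypothesis subA : is_subspace A.

Lemma subspace0 : A 0. Proof. exact: subA.1. Qed.

Lemma subspaceD x y : A x -> A y -> A (x + y).
Proof. by move=> Ax Ay; rewrite -[x]scale1r; exact: subA.2. Qed.

Lemma subspaceZ a x : A x -> A (a *: x).
Proof. by move=> Ax; rewrite -[_ *: x]addr0; apply: (subA.2 _ _ _ Ax);
  exact: subspace0. Qed.

Lemma subspaceN x : A x -> A (- x).
Proof. by rewrite -scaleN1r; exact: subspaceZ. Qed.

Lemma subspaceB x y : A x -> A y -> A (x - y).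
Proof. by move=> Ax /subspaceN; exact: subspaceD. Qed.

Lemma subspace_sum n (f : 'I_n -> V) : (forall i, A (f i)) -> A (\sum_i f i).
Proof.
by move=> Af; elim/big_ind: _ => //; [exact: subspace0 | exact: subspaceD].
Qed.

End Closure.

Lemma subspaceI (V : lmodType R[i]) (A B : set V) :
  is_subspace A -> is_subspace B -> is_subspace (A `&` B).
Proof.
move=> sA sB; split; first by split; exact: subspace0.
by move=> a x y [Ax Bx] [Ay By]; split; [apply: sA.2 | apply: sB.2].
Qed.

Lemma subspace_preimage (V W : lmodType R[i]) (f : {linear V -> W}) (A : set W) :
  is_subspace A -> is_subspace (f @^-1` A).
Proof.
move=> sA; split; first by rewrite /= linear0; exact: subspace0.
by move=> a x y /= Ax Ay; rewrite linearP; apply: sA.2.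
Qed.

Lemma subspace_image (V W : lmodType R[i]) (f : {linear V -> W}) (A : set V) :
  is_subspace A -> is_subspace (f @` A).
Proof.
move=> sA; split; first by exists 0; [exact: subspace0 | rewrite linear0].
move=> a _ _ [x Ax <-] [y Ay <-]; exists (a *: x + y); last by rewrite linearP.
exact: sA.2.
Qed.

Lemma subspace_set0 (V : lmodType R[i]) : is_subspace [set (0 : V)].
Proof. by split => // a x y /= -> ->; rewrite scaler0 addr0. Qed.

Lemma subspaceT (V : lmodType R[i]) : is_subspace [set: V].
Proof. by split. Qed.

End Subspaces.

(** * Closed linear relations *)

Section ClosedRelations.
Context {R : realType} {V W : normedModType R[i]}.
Variable G : set (V * W)%type.
Hypotheses (subG : is_subspace G) (closedG : closed G).

Definition domain := [set x | exists z, G (x, z)].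

Lemma subspace_domain : is_subspace domain.
Proof.
split; first by exists 0; exact: (subspace0 subG).
by move=> a x y [z Gz] [w Gw]; exists (a *: z + w); exact: (subG.2 a (_, _) (_, _)).
Qed.

(** A closed subspace G of V * W serves as a multivalued operator, and [domain G]
    as an operator range. Termwise selections of a convergent series in the
    domain add up to a selection at its sum. *)
Lemma relation_series (x : nat -> V) (z : nat -> W) (K : R) l :
  series_complete W -> (forall k, G (x k, z k)) ->
  (forall k, nrm (z k) <= K / 2 ^+ k) ->
  (forall e, 0 < e ->
     exists N, forall n, (N <= n)%N -> nrm (l - \sum_(k < n) x k) < e) ->
  exists2 w, G (l, w) & nrm w <= 2 * K.
Proof.
move=> cW Gxz zK xl; have [w wP] := cW _ _ zK; exists w; last first.
  by have := wP 0%N; rewrite big_ord0 subr0 expr0 divr1.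
apply: closed_adherent closedG _ => e e0.
have [N Nx] := xl _ e0; have [M Mz] := pow_half_small (2 * K) e0.
pose n := maxn N M.
exists (\sum_(k < n) x k, \sum_(k < n) z k).
  elim: n => [|n IH]; first by rewrite !big_ord0; exact: (subspace0 subG).
  by rewrite !big_ord_recr; exact: (subspaceD subG IH (Gxz n)).
rewrite nrm_pair_lt Nx ?leq_maxl //=.
by apply: le_lt_trans (wP n) (Mz _ _); exact: leq_maxr.
Qed.

(** A converse of the open mapping theorem: an adherent point of the domain is
    the sum of a geometrically small series in the domain, and the bounded
    selections of its terms form a convergent series. *)
Lemma bounded_selection_closed (C : R) : series_complete W ->
  (forall x, domain x -> exists2 z, G (x, z) & nrm z <= C * nrm x) ->
  closed domain.
Proof.
move=> cW sel; apply: adherent_closed => x adx.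
have C0 : 0 <= C \/ forall y, domain y -> y = 0.
  have [C0|C0] := leP 0 C; [by left | right => y /sel[z _ zy]].
  apply: nrm_eq0; apply/eqP; rewrite eq_le nrm_ge0 andbT.
  by have := le_trans (nrm_ge0 z) zy; rewrite nmulr_rge0.
case: C0 => [C0|D0]; last first.
  suff -> : x = 0 by exact: (subspace0 subspace_domain).
  apply: nrm_eq0; apply/eqP; rewrite eq_le nrm_ge0 andbT.
  apply/ler_addgt0Pl => e /adx[y /D0 ->]; rewrite subr0 addr0; exact: ltW.
have /choice[y yP] : forall k, exists y, domain y /\ nrm (x - y) < 1 / 2 ^+ k.
  move=> k; have [|y Dy xy] := adx (1 / 2 ^+ k); last by exists y.
  by rewrite divr_gt0 // exprn_gt0.
pose u k := if k is j.+1 then y j.+1 - y j else y 0%N.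
have Du k : domain (u k).
  case: k => [|k] /=; first exact: (yP _).1.
  exact: (subspaceB subspace_domain (yP _).1 (yP _).1).
have uK k : nrm (u k) <= (3 + nrm (y 0%N)) / 2 ^+ k.
  case: k => [|k] /=; first by rewrite expr0 divr1 lerDr.
  apply: le_trans (nrm_tri x _ _) _; rewrite nrm_distC.
  have := (yP k).2; have := (yP k.+1).2; rewrite exprS invfM.
  have A0 : 0 < (2 ^+ k : R)^-1 by rewrite invr_gt0 exprn_gt0.
  have := nrm_ge0 (y 0%N); move: A0; set A := (2 ^+ k)^-1; nra.
have sum_u n : \sum_(k < n.+1) u k = y n.
  elim: n => [|n IH]; first by rewrite big_ord1.
  by rewrite big_ord_recr /= IH addrC subrK.
have /choice[z zP] : forall k, exists z, G (u k, z) /\ nrm z <= C * nrm (u k).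
  by move=> k; have [z ? ?] := sel _ (Du k); exists z.
have [||w] := @relation_series u z (C * (3 + nrm (y 0%N))) x cW
  (fun k => (zP k).1).
- by move=> k; apply: le_trans (zP k).2 _; rewrite -mulrA ler_wpM2l.
- move=> e e0; have [N NP] := pow_half_small 1 e0; exists N.+1 => -[//|n] Nn.
  by rewrite sum_u; apply: lt_trans (yP n).2 (NP _ Nn).
by move=> Gw _; exists w.
Qed.

End ClosedRelations.

Arguments domain {R V W} G.

(** * The open mapping theorem *)

Section OpenMapping.
Context {R : realType}.

(** Baire's theorem inside a closed set D of V: if no A n were adherent to a
    relative ball of D, then nested balls of D with geometrically decreasing
    radii, the n-th one avoiding A n, would have a common point outside all
    of the A n. *)
Lemma baire_adherent (V : normedModType R[i]) (D : set V) (A : nat -> set V) :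
  series_complete V -> closed D -> D !=set0 ->
  (forall x, D x -> exists n, A n x) ->
  exists n x0 (r : R), [/\ D x0, 0 < r &
    forall x, D x -> nrm (x - x0) < r -> adherent (A n) x].
Proof.
move=> cV cD [x0 Dx0] DA; apply: contrapT => nope.
have step n (p : V * R) : exists q : V * R, D p.1 -> 0 < p.2 ->
    [/\ D q.1, 0 < q.2, nrm (q.1 - p.1) < p.2 / 4, q.2 <= p.2 / 2 &
      forall w, A n w -> q.2 <= nrm (q.1 - w)].
  (* Moving by a quarter and halving the radius keeps all later centres, and
     the limit, within half the radius of the current centre. *)
  apply: contrapT => /forallNP nq; apply: nope; exists n, p.1, (p.2 / 4).
  have [Dp p0] : D p.1 /\ 0 < p.2.
    split; first by apply: contrapT => nD; apply: (nq p).
    by apply: contrapT => nD; apply: (nq p).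
  split => //; first lra.
  move=> x Dx xp e e0; apply: contrapT => nad.
  apply: (nq (x, Num.min e (p.2 / 2))) => _ _ /=.
  split=> //; first by rewrite lt_min e0; lra.
    by rewrite ge_min lexx orbT.
  move=> w Aw; rewrite ge_min; apply/orP; left; rewrite leNgt.
  by apply/negP => xw; apply: nad; exists w.
have /choice[f fP] : forall np : nat * (V * R), exists q : V * R,
    D np.2.1 -> 0 < np.2.2 ->
    [/\ D q.1, 0 < q.2, nrm (q.1 - np.2.1) < np.2.2 / 4, q.2 <= np.2.2 / 2 &
      forall w, A np.1 w -> q.2 <= nrm (q.1 - w)].
  by move=> [n p]; exact: step.
pose p := fix p n := if n is m.+1 then f (m, p m) else (x0, 1).
have pP n : D (p n).1 /\ 0 < (p n).2.
  elim: n => [|n [Dn n0]]; first by split.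
  by have [] := fP (n, p n) Dn n0.
have pS n := fP (n, p n) (pP n).1 (pP n).2.
pose z k := (p k.+1).1 - (p k).1.
have r_le n : (p n).2 <= 1 / 2 ^+ n.
  elim: n => [|n IH]; first by rewrite expr0 divr1.
  case: (pS n) => _ _ _ + _; rewrite exprS invfM /= => /le_trans; apply.
  by move: IH; set B := (2 ^+ n)^-1; lra.
have zK k : nrm (z k) <= 4^-1 / 2 ^+ k.
  case: (pS k) => _ _ /ltW /le_trans + _ _; apply.
  by have := r_le k; set B := (2 ^+ k)^-1; lra.
have [l lP] := cV _ _ zK.
have sum_z n : \sum_(k < n) z k = (p n).1 - x0.
  elim: n => [|n IH]; first by rewrite big_ord0 subrr.
  by rewrite big_ord_recr /= IH addrC addrA subrK.
pose x := x0 + l.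
have xp n : nrm (x - (p n).1) <= 2 * 4^-1 / 2 ^+ n.
  by have := lP n; rewrite sum_z opprB addrA [l + _]addrC.
have small e : 0 < e -> exists N, forall n, (N <= n)%N -> nrm (x - (p n).1) < e.
  move=> e0; have [N NP] := pow_half_small (2 * 4^-1) e0; exists N => n /NP.
  exact: le_lt_trans.
have drift n k : nrm ((p (n + k)%N).1 - (p n).1) <= ((p n).2 - (p (n + k)%N).2) / 2.
  elim: k => [|k IH]; first by rewrite addn0 !subrr nrm0 mul0r.
  rewrite addnS; apply: le_trans (nrm_tri (p (n + k)%N).1 _ _) _.
  by case: (pS (n + k)%N) => _ _ /=; lra.
have in_ball n : nrm ((p n).1 - x) <= (p n).2 / 2.
  apply/ler_addgt0Pl => e /small[N Ns]; rewrite nrm_distC.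
  apply: le_trans (nrm_tri (p (n + N)%N).1 _ _) _.
  apply: lerD; first by apply/ltW/Ns; exact: leq_addl.
  by apply: le_trans (drift n N) _; have := (pP (n + N)%N).2; lra.
have Dx : D x.
  apply: closed_adherent cD _ => e /small[N /(_ N (leqnn _)) Ns].
  by exists (p N).1 => //; exact: (pP N).1.
have [n Anx] := DA _ Dx; have := in_ball n.+1.
by case: (pS n) => /= _ r0 _ _ /(_ _ Anx); lra.
Qed.

(** The open mapping theorem for a closed relation with closed domain. By Baire,
    some ball of the domain is adherent to the points with a value of norm at most
    n; differences of points in this ball then show that every point x of the
    domain is approximated by points with a value of norm at most C times that of
    x, and iterating on the error term gives a series for x itself. *)
Lemma open_mapping (V W : normedModType R[i]) (G : set (V * W)%type) :
  series_complete V -> series_complete W ->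
  is_subspace G -> closed G -> closed (domain G) ->
  exists2 C : R, 0 < C &
    forall x, domain G x -> exists2 z, G (x, z) & nrm z <= C * nrm x.
Proof.
move=> cV cW subG clG clD; pose D := domain G.
have sD : is_subspace D := subspace_domain subG.
pose A (n : nat) := [set x | exists2 z, G (x, z) & nrm z <= n%:R].
have DA x : D x -> exists n, A n x.
  move=> [z Gz]; exists (Num.bound (nrm z)), z => //.
  by apply/ltW/archi_boundP; exact: nrm_ge0.
have [n [x0 [r [Dx0 r0 ball_ad]]]] : exists n x0 (r : R), [/\ D x0, 0 < r &
    forall x, D x -> nrm (x - x0) < r -> adherent (A n) x].
  by apply: baire_adherent => //; exists 0; exact: (subspace0 sD).
pose C := 4 * n%:R / r + 1.
have C0 : 0 < C.
  by rewrite /C ltr_pwDr // mulr_ge0 ?mulr_ge0 ?ler0n // invr_ge0 ltW.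
have approx x e : D x -> 0 < e ->
    exists q : V * W, [/\ G q, nrm q.2 <= C * nrm x & nrm (x - q.1) < e].
  move=> Dx e0; have [->|x_neq0] := eqVneq x 0.
    exists 0; split; first exact: (subspace0 subG).
      by rewrite !nrm0 mulr0.
    by rewrite subrr nrm0.
  have a0 := nrm_gt0 x_neq0; pose t := r / (2 * nrm x).
  have t0 : 0 < t by rewrite divr_gt0 // mulr_gt0.
  have tC : t%:C != 0 :> R[i] by rewrite (inj_eq (@complexI R)) gt_eqF.
  have te : 0 < t * e / 2 by apply: divr_gt0 => //; apply: mulr_gt0.
  have tx : nrm (t%:C *: x) < r.
    rewrite (nrmZr _ (ltW t0)) (_ : t * nrm x = r / 2); first lra.
    by rewrite /t; field; rewrite gt_eqF.
  have Dtx : D (t%:C *: x + x0) by exact: (subspaceD sD (subspaceZ sD _ Dx) Dx0).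
  have [u1 [w1 Gw1 w1n] u1e] : exists2 u, A n u &
      nrm (t%:C *: x + x0 - u) < t * e / 2.
    by apply: ball_ad => //; rewrite addrK.
  have [u2 [w2 Gw2 w2n] u2e] : exists2 u, A n u & nrm (x0 - u) < t * e / 2.
    by apply: ball_ad => //; rewrite subrr nrm0.
  have t'0 : 0 < t^-1 by rewrite invr_gt0.
  exists ((t^-1)%:C *: (u1 - u2), (t^-1)%:C *: (w1 - w2)); split.
  - exact: (subspaceZ subG _ (subspaceB subG Gw1 Gw2)).
  - rewrite (nrmZr _ (ltW t'0)) /=.
    apply: le_trans (_ : t^-1 * (2 * n%:R) <= _).
      by rewrite ler_pM2l //; apply: le_trans (nrmB _ _) _; lra.
    have -> : t^-1 * (2 * n%:R) = 4 * n%:R / r * nrm x.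
      by rewrite /t; field; rewrite !gt_eqF.
    by rewrite ler_wpM2r ?nrm_ge0 // /C lerDl.
  have -> : x - (t^-1)%:C *: (u1 - u2) =
      (t^-1)%:C *: ((t%:C *: x + x0 - u1) - (x0 - u2)).
    rewrite opprB [u2 - x0]addrC addrACA addrK [- u1 + u2]addrC -[u2 - u1]opprB.
    by rewrite [RHS]scalerBr scalerA -rmorphM /= mulVf ?gt_eqF // scale1r.
  rewrite (nrmZr _ (ltW t'0)) ltr_pdivrMl //.
  apply: le_lt_trans (nrmB _ _) _; lra.
have /choice[f fP] : forall ky : R * V, exists q : V * W, D ky.2 -> 0 < ky.1 ->
    [/\ G q, nrm q.2 <= C * nrm ky.2 & nrm (ky.2 - q.1) < ky.1].
  move=> [e y] /=; have [[Dy e0]|nDe] := pselect (D y /\ 0 < e).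
    by have [q] := approx y e Dy e0; exists q.
  by exists 0 => Dy e0; case: nDe.
exists (2 * C); first by rewrite mulr_gt0.
move=> x Dx; have [->|x_neq0] := eqVneq x 0.
  by exists 0; rewrite ?nrm0 ?mulr0 //; exact: (subspace0 subG).
have a0 := nrm_gt0 x_neq0; set a := nrm x in a0 *.
pose e k := a / 2 ^+ k.+1.
have e0 k : 0 < e k by rewrite divr_gt0 // exprn_gt0.
pose y := fix y n := if n is m.+1 then y m - (f (e m, y m)).1 else x.
have Dy k : D (y k).
  elim: k => [//|k IH] /=; have [Gq _ _] := fP (e k, y k) IH (e0 k).
  apply: (subspaceB sD IH); exists (f (e k, y k)).2.
  by rewrite -surjective_pairing.
have fyP k := fP (e k, y k) (Dy k) (e0 k).
have ya k : nrm (y k) <= a / 2 ^+ k.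
  case: k => [|k]; first by rewrite expr0 divr1.
  by case: (fyP k) => _ _ /ltW.
have sum_y m : \sum_(k < m) (f (e k, y k)).1 = x - y m.
  elim: m => [|m IH]; first by rewrite big_ord0 subrr.
  by rewrite big_ord_recr /= IH opprB addrA addrAC.
rewrite -mulrA -/a.
apply: (relation_series subG clG (x := fun k => (f (e k, y k)).1)
  (z := fun k => (f (e k, y k)).2)) => //.
- by move=> k; rewrite -surjective_pairing; case: (fyP k).
- move=> k; case: (fyP k) => _ /le_trans + _; apply.
  by rewrite -mulrA ler_pM2l //; exact: ya.
move=> d d0; have [N NP] := pow_half_small a d0; exists N => m /NP.
by rewrite sum_y opprB addrC subrK; exact: le_lt_trans.
Qed.

End OpenMapping.

(** * Finite-dimensional extensions and complements *)

Section Complements.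
Context {R : realType}.

Lemma closed_continuous_preimage (T U : topologicalType) (f : T -> U) (D : set U) :
  continuous f -> closed D -> closed (f @^-1` D).
Proof. by move=> cf; apply: preimage_closed => x _; exact: cf. Qed.

Definition add_line (V : lmodType R[i]) (Z : set V) e :=
  [set x | exists c : R[i], Z (x - c *: e)].

Definition add_span (V : lmodType R[i]) (Z : set V) n (e : 'I_n -> V) :=
  [set x | exists c : 'I_n -> R[i], Z (x - \sum_i c i *: e i)].

Lemma subspace_add_line (V : lmodType R[i]) (Z : set V) e :
  is_subspace Z -> is_subspace (add_line Z e).
Proof.
move=> sZ; split.
  by exists 0; rewrite scale0r subr0; exact: (subspace0 sZ).
move=> a x y [c Zx] [d Zy]; exists (a * c + d).
have -> : a *: x + y - (a * c + d) *: e = a *: (x - c *: e) + (y - d *: e).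
  by rewrite scalerDl -scalerA scalerBr opprD addrACA.
exact: sZ.2.
Qed.

Lemma add_span0 (V : lmodType R[i]) (Z : set V) (e : 'I_0 -> V) :
  add_span Z e = Z.
Proof.
apply/seteqP; split=> [x [c]|x Zx]; first by rewrite big_ord0 subr0.
by exists (fun=> 0); rewrite big_ord0 subr0.
Qed.

Lemma add_spanS (V : lmodType R[i]) (Z : set V) n (e : 'I_n.+1 -> V) :
  add_span Z e = add_span (add_line Z (e ord0)) (fun i => e (lift ord0 i)).
Proof.
apply/seteqP; split=> [x [c]|x [c [d]]].
  rewrite big_ord_recl => Zx; exists (fun i => c (lift ord0 i)), (c ord0).
  by rewrite -addrA -opprD [X in x - X]addrC.
move=> Zx; exists (fun i => oapp c d (unlift ord0 i)).
rewrite big_ord_recl unlift_none /=.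
under eq_bigr do rewrite liftK /=.
by rewrite [X in x - X]addrC opprD addrA.
Qed.

Lemma continuous_linear_fst_scale (V : normedModType R[i]) (e : V) :
  continuous (fun p : V * R[i]^o => p.1 - (p.2 : R[i]) *: e).
Proof.
move=> p; apply: cvgB; first exact: cvg_fst.
by apply: cvgZr_tmp; exact: cvg_snd.
Qed.

(** If e is not in Z, it has a positive distance d from Z, so the coefficient c
    of x along e satisfies d |c| <= |x|, and [bounded_selection_closed] applies
    to the relation between x and c. *)
Lemma closed_add_line (V : normedModType R[i]) (Z : set V) (e : V) :
  is_subspace Z -> closed Z -> closed (add_line Z e).
Proof.
move=> sZ cZ; pose G := [set p : V * R[i]^o | Z (p.1 - (p.2 : R[i]) *: e)].
have sG : is_subspace G.
  split; first by rewrite /G /= scale0r subr0; exact: (subspace0 sZ).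
  move=> a [x c] [y d] /= Zx Zy; rewrite /G /=.
  have -> : a *: x + y - (a *: c + d) *: e = a *: (x - c *: e) + (y - d *: e).
    by rewrite scalerDl -scalerA scalerBr opprD addrACA.
  exact: sZ.2.
have cG : closed G.
  exact: (closed_continuous_preimage (@continuous_linear_fst_scale _ e) cZ).
suff [C sel] : exists C : R, forall x c, G (x, c) ->
    exists2 d, G (x, d) & nrm d <= C * nrm x.
  apply: (bounded_selection_closed sG cG scalar_series_complete (C := C)).
  by move=> x [c] /sel.
have [Ze|nZe] := pselect (Z e).
  exists 0 => x c Gx; exists 0; last by rewrite nrm0 mul0r.
  rewrite /G /= scale0r subr0 -(subrK (c *: e) x).
  by apply: (subspaceD sZ) => //; exact: (subspaceZ sZ).
have [d d0 dP] : exists2 d : R, 0 < d & forall z, Z z -> d <= nrm (e - z).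
  apply: contrapT => nd; apply/nZe/(closed_adherent cZ) => d d0.
  apply: contrapT => nz; apply: nd; exists d => // z Zz.
  by rewrite leNgt; apply/negP => ez; apply: nz; exists z.
exists d^-1 => x c Gx; exists c => //.
have [->|c0] := eqVneq c 0; first by rewrite nrm0 mulr_ge0 ?nrm_ge0 ?invr_ge0 ?ltW.
rewrite ler_pdivlMl // -ler_pdivlMr ?nrm_gt0 //.
have := dP (- (c^-1 *: (x - c *: e))) (subspaceN sZ (subspaceZ sZ _ Gx)).
rewrite opprK scalerBr scalerA mulVf // scale1r addrC subrK nrmZ.
move=> /le_trans; apply; rewrite mulrC ler_wpM2l ?nrm_ge0 //.
rewrite -(ler_pM2l (nrm_gt0 c0)) divff ?gt_eqF ?nrm_gt0 //.
by rewrite -nrmZ /GRing.scale /= mulfV // nrm_real.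
Qed.

Lemma subspace_add_span (V : lmodType R[i]) (Z : set V) n (e : 'I_n -> V) :
  is_subspace Z -> is_subspace (add_span Z e).
Proof.
elim: n Z e => [|n IH] Z e sZ; first by rewrite add_span0.
by rewrite add_spanS; apply: IH; exact: subspace_add_line.
Qed.

Lemma closed_add_span (V : normedModType R[i]) (Z : set V) n (e : 'I_n -> V) :
  is_subspace Z -> closed Z -> closed (add_span Z e).
Proof.
elim: n Z e => [|n IH] Z e sZ cZ; first by rewrite add_span0.
rewrite add_spanS; apply: IH; first exact: subspace_add_line.
exact: closed_add_line.
Qed.

Section ComplementBound.
Context {V W : normedModType R[i]} {G : set (V * W)%type} {E : set V}.
Hypotheses (cV : series_complete V) (cW : series_complete W).
Hypotheses (sG : is_subspace G) (cG : closed G).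
Hypotheses (sE : is_subspace E) (cE : closed E).
Hypothesis cover : forall x, exists2 v, E v & domain G (x - v).
Hypothesis direct : forall x, E x -> domain G x -> x = 0.

(** The projection onto E along the operator range [domain G] is bounded: apply
    the open mapping theorem to the decompositions x = (x - v) + v, recorded with
    a value u of G at x - v. *)
Lemma complement_bound : exists2 C : R, 0 < C &
  forall x v, E v -> domain G (x - v) -> nrm v <= C * nrm x.
Proof.
pose H := [set p : V * (W * V) | E p.2.2 /\ G (p.1 - p.2.2, p.2.1)].
have sH : is_subspace H.
  split.
    rewrite /H /= subr0; split; first exact: (subspace0 sE).
    exact: (subspace0 sG).
  move=> a [x [u v]] [y [u' v']] [/= Ev Gx] [/= Ev' Gy]; split => /=.
    exact: sE.2.
  have := sG.2 a _ _ Gx Gy; congr G; congr pair => /=.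
  by rewrite scalerBr opprD addrACA.
have cH : closed H.
  apply: (@closedI _ [set p : V * (W * V) | E p.2.2]
                     [set p : V * (W * V) | G (p.1 - p.2.2, p.2.1)]).
    apply: (closed_continuous_preimage (f := fun p : V * (W * V) => p.2.2)) cE.
    by move=> p; apply: cvg_comp; exact: cvg_snd.
  apply: (closed_continuous_preimage
    (f := fun p : V * (W * V) => (p.1 - p.2.2, p.2.1))) cG.
  move=> p; apply: cvg_pair => /=.
    apply: cvgB; first exact: cvg_fst.
    by apply: cvg_comp; exact: cvg_snd.
  by apply: cvg_comp; [exact: cvg_snd | exact: cvg_fst].
have domH : domain H = setT.
  apply/seteqP; split=> // x _; have [v Ev [u Gu]] := cover x.
  by exists (u, v).
have cWV := pair_series_complete cW cV.
have cdH : closed (domain H) by rewrite domH; exact: closedT.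
have [C C0 CP] := open_mapping cV cWV sH cH cdH.
exists C => // x v Ev Dv.
have [[u w] [/= Ew Gw] uw] : exists2 z, H (x, z) & nrm z <= C * nrm x.
  by apply: CP; rewrite domH.
have : nrm w <= C * nrm x.
  by move: uw; rewrite nrm_pair_le => /andP[].
suff -> : v = w by [].
apply/eqP; rewrite -subr_eq0; apply/eqP/direct; first exact: (subspaceB sE).
have -> : v - w = (x - w) - (x - v).
  by rewrite opprB [v - x]addrC addrACA addrN add0r addrC.
apply: (subspaceB (subspace_domain sG)) => //.
by exists u.
Qed.

Lemma complemented_domain_closed : closed (domain G).
Proof.
have [C C0 CP] := complement_bound.
have sD := subspace_domain sG.
apply: adherent_closed => x adx; have [v Ev Dv] := cover x.
suff v0 : v = 0 by rewrite v0 subr0 in Dv.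
apply: nrm_eq0; apply/eqP; rewrite eq_le nrm_ge0 andbT.
apply/ler_addgt0Pl => e e0; rewrite addr0.
have eC : 0 < C^-1 * e by rewrite mulr_gt0 ?invr_gt0.
have [y Dy xy] := adx _ eC.
have := CP (x - y) v Ev; rewrite addrAC => /(_ (subspaceB sD Dv Dy)).
by move/le_trans; apply; rewrite -ler_pdivlMl //; exact: ltW.
Qed.

Lemma closed_complement_sum (F : set V) : is_subspace F -> F `<=` domain G ->
  closed F -> closed [set x | exists2 v, E v & F (x - v)].
Proof.
move=> sF FD cF; have [C C0 CP] := complement_bound.
have sD := subspace_domain sG.
apply: adherent_closed => x adx; have [v Ev Dv] := cover x; exists v => //.
apply: closed_adherent cF _ => e e0.
have eC : 0 < e / (1 + C) by rewrite divr_gt0 // addr_gt0.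
have [y [w Ew Fw] xy] := adx _ eC; exists (y - w) => //.
have swap : x - v - (y - w) = (x - y) - (v - w).
  by rewrite !opprB addrACA [RHS]addrACA [- v - y]addrC.
rewrite swap; apply: le_lt_trans (nrmB _ _) _.
apply: le_lt_trans (_ : nrm (x - y) + C * nrm (x - y) < _).
  rewrite lerD2l; apply: CP; first exact: (subspaceB sE).
  by rewrite -swap; apply: (subspaceB sD) => //; exact: FD.
move: xy; rewrite ltr_pdivlMr ?addr_gt0 //; lra.
Qed.

End ComplementBound.
End Complements.

(** * Dimensions of quotients *)

Section Dimension.
Context {R : realType} {X : completeNormedModType R[i]}.
Implicit Types (L M N : set X) (n m : nat).

Definition has_dim M N n := exists e : 'I_n -> X, basis_mod M N e.

Lemma has_dim_trivial M N n : M `<=` N -> is_subspace N ->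
  has_dim M N n <-> n = 0%N.
Proof.
move=> MN sN; split=> [[e [Me free _]] | ->]; last first.
  exists (fun=> 0); split=> [[]//|c _ []//|x Mx].
  by exists (fun=> 0); rewrite big_ord0 subr0; exact: MN.
case: n e Me free => // n e Me free.
suff /(free (fun=> 1))/(_ ord0)/eqP : N (\sum_i 1 *: e i) by rewrite oner_eq0.
by apply: (subspace_sum sN) => i; rewrite scale1r; exact/MN/Me.
Qed.

Lemma has_dim_le1 N e : is_subspace N -> ~ N e -> has_dim (add_line N e) N 1.
Proof.
move=> sN nNe; exists (fun=> e); split=> [_|c|x [c Nx]].
- by exists 1; rewrite scale1r subrr; exact: (subspace0 sN).
- rewrite big_ord1 => Nce i; rewrite ord1; apply: contra_notP nNe => /eqP c0.
  by rewrite -[e](scalerK c0); exact: (subspaceZ sN).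
- by exists (fun=> c); rewrite big_ord1.
Qed.

Lemma linear_comb (f : {linear X -> X}) n (c : 'I_n -> R[i]) (e : 'I_n -> X) :
  f (\sum_i c i *: e i) = \sum_i c i *: f (e i).
Proof. by rewrite linear_sum; apply: eq_bigr => i _; rewrite linearZ. Qed.

Lemma has_dim_iso (f : {linear X -> X}) M N M' N' n : is_subspace N' ->
  (forall x, M x -> M' (f x)) -> (forall x, M x -> N' (f x) <-> N x) ->
  (forall y, M' y -> exists2 x, M x & N' (y - f x)) ->
  is_subspace M ->
  has_dim M N n <-> has_dim M' N' n.
Proof.
move=> sN' fM fN fsurj sM; split=> -[e [Me free span]].
  exists (f \o e); split=> [i|c|y My] /=; first exact/fM/Me.
    move=> Nc; apply: free; apply/fN.
      by apply: (subspace_sum sM) => i; exact: (subspaceZ sM).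
    by rewrite linear_comb.
  have [x Mx Nyx] := fsurj _ My; have [c Nc] := span _ Mx; exists c.
  have Mc : M (x - \sum_i c i *: e i).
    apply: (subspaceB sM) => //; apply: (subspace_sum sM) => i.
    exact: (subspaceZ sM).
  have := subspaceD sN' Nyx ((fN _ Mc).2 Nc).
  by rewrite linearB addrA subrK linear_comb.
have /choice[d dP] : forall i, exists x, M x /\ N' (e i - f x).
  by move=> i; have [x ? ?] := fsurj _ (Me i); exists x.
have Nde c : N' (\sum_i c i *: e i - f (\sum_i c i *: d i)).
  rewrite linear_comb -sumrB; apply: (subspace_sum sN') => i.
  by rewrite -scalerBr; apply: (subspaceZ sN'); exact: (dP i).2.
have Md c : M (\sum_i c i *: d i).
  by apply: (subspace_sum sM) => i; apply: (subspaceZ sM); exact: (dP i).1.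
exists d; split=> [i|c Nc|x Mx]; first exact: (dP i).1.
  apply: free; rewrite -[X in N' X](subrK (f (\sum_i c i *: d i))).
  by apply: (subspaceD sN'); [exact: Nde | apply/fN].
have [c Nc] := span _ (fM _ Mx); exists c.
apply/fN; first exact: (subspaceB sM).
rewrite linearB -(subrK (\sum_i c i *: e i) (f x)) -addrA.
by apply: (subspaceD sN').
Qed.

Lemma has_dim_add M L N m n : is_subspace M -> is_subspace L -> is_subspace N ->
  N `<=` L -> L `<=` M ->
  has_dim M L m -> has_dim L N n -> has_dim M N (m + n).
Proof.
move=> sM sL sN NL LM [e [Me freee spane]] [d [Ld freed spand]].
pose ed (i : 'I_(m + n)) :=
  match fintype.split i with inl j => e j | inr j => d j end.
have sum_ed c : \sum_i c i *: ed i = \sum_i c (lshift n i) *: e i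
    + \sum_i c (rshift m i) *: d i.
  rewrite big_split_ord /=; congr (_ + _); apply: eq_bigr => i _.
    rewrite /ed; case: split_ordP => j /eqP; rewrite ?eq_lshift ?eq_lrshift //.
    by move=> /eqP ->.
  rewrite /ed; case: split_ordP => j /eqP; rewrite ?eq_rshift ?eq_rlshift //.
  by move=> /eqP ->.
have Ldc (c : 'I_n -> R[i]) : L (\sum_i c i *: d i).
  by apply: (subspace_sum sL) => i; exact: (subspaceZ sL).
exists ed; split=> [i|c|x Mx].
- by rewrite /ed; case: (fintype.split i) => j //; exact/LM/Ld.
- rewrite sum_ed => Nc.
  have c0 : forall i, c (lshift n i) = 0.
    apply: (freee (fun i => c (lshift n i))).
    rewrite -[X in L X](addrK (\sum_i c (rshift m i) *: d i)).
    by apply: (subspaceB sL) => //; exact: NL.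
  have d0 : forall i, c (rshift m i) = 0.
    apply: (freed (fun i => c (rshift m i))).
    by move: Nc; rewrite big1 ?add0r // => i _; rewrite c0 scale0r.
  by move=> i; case: (split_ordP i) => j ->.
have [a La] := spane _ Mx; have [b Nb] := spand _ La.
exists (fun i : 'I_(m + n) =>
  match fintype.split i with inl j => a j | inr j => b j end).
rewrite sum_ed opprD addrA; move: Nb; congr N; congr (_ - _ - _).
  apply: eq_bigr => i _; case: split_ordP => j /eqP.
    by rewrite eq_lshift => /eqP ->.
  by rewrite eq_lrshift.
apply: eq_bigr => i _; case: split_ordP => j /eqP.
  by rewrite eq_rlshift.
by rewrite eq_rshift => /eqP ->.
Qed.

(** This is stated as the existence of a pair of dimensions, so that additivity
    can be used in both directions without knowing that dimensions are unique.
    The proof is by induction on n: enlarge N and L by the line of the first basis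
    vector, which adds 1 to the dimension of L / N or of M / L according to
    whether that vector is in L. *)
Lemma has_dim_split M L N n : is_subspace M -> is_subspace L -> is_subspace N ->
  N `<=` L -> L `<=` M -> has_dim M N n ->
  exists a b, [/\ has_dim M L a, has_dim L N b & (a + b = n)%N].
Proof.
move=> sM + + + + [e]; elim: n L N e => [|n IH] L N e sL sN NL LM [Me free span].
  have MN : M `<=` N.
    by move=> x /span[c]; rewrite big_ord0 subr0.
  exists 0%N, 0%N; split=> //; apply/has_dim_trivial => //.
    by apply: subset_trans MN NL.
  by apply: subset_trans LM MN.
pose e0 := e ord0; pose N' := add_line N e0; pose L' := add_line L e0.
have sN' : is_subspace N' by exact: subspace_add_line.
have sL' : is_subspace L' by exact: subspace_add_line.
have line_incl (A B : set X) : A `<=` B -> add_line A e0 `<=` add_line B e0.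
  by move=> AB x [c Ax]; exists c; exact: AB.
have self A : is_subspace A -> A `<=` add_line A e0.
  by move=> sA x Ax; exists 0; rewrite scale0r subr0.
have L'M : L' `<=` M.
  move=> x [c /LM Mx]; rewrite -(subrK (c *: e0) x).
  by apply: (subspaceD sM) => //; apply: (subspaceZ sM); exact: Me.
have nNe0 : ~ N e0.
  move=> Ne0; suff /(free (fun i => (i == ord0)%:R))/(_ ord0)/eqP :
      N (\sum_i (i == ord0)%:R *: e i) by rewrite eqxx oner_eq0.
  rewrite (bigD1 ord0) //= scale1r big1 ?addr0 // => i /negPf ->.
  by rewrite scale0r.
have basis' : basis_mod M N' (fun i => e (lift ord0 i)).
  split=> [i|c [d Nc]|x Mx]; first exact: Me.
    pose c' i := oapp c (- d) (unlift ord0 i).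
    have : forall i, c' i = 0.
      apply: free; rewrite big_ord_recl /c' unlift_none /=.
      under eq_bigr do rewrite liftK /=.
      by rewrite scaleNr addrC.
    by move=> c0 i; have := c0 (lift ord0 i); rewrite /c' liftK.
  have [c Nc] := span _ Mx; exists (fun i => c (lift ord0 i)), (c ord0).
  by move: Nc; rewrite big_ord_recl opprD addrA addrAC.
have [a [b [dimML' dimL'N' abn]]] :=
  IH L' N' _ sL' sN' (line_incl _ _ NL) L'M basis'.
have [Le0|nLe0] := pselect (L e0).
  have L'L : L' = L.
    apply/seteqP; split; last exact: self.
    move=> x [c Lx]; rewrite -(subrK (c *: e0) x).
    by apply: (subspaceD sL) => //; exact: (subspaceZ sL).
  rewrite L'L in dimML' dimL'N'.
  exists a, (b + 1)%N; split=> //; last by rewrite addnA abn addn1.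
  apply: has_dim_add dimL'N' _ => //; first exact: self.
    by rewrite -L'L; exact: line_incl.
  exact: has_dim_le1.
exists (a + 1)%N, b; split; last by rewrite addn1 addSn abn.
  by apply: has_dim_add dimML' _ => //; [exact: self | exact: has_dim_le1].
apply/(has_dim_iso (f := idfun) (M' := L') (N' := N')) => //.
- exact: self.
- move=> x Lx; split=> [[c Nc]|]; last exact: self.
  have [c0|c0] := eqVneq c 0; first by move: Nc; rewrite c0 scale0r subr0.
  exfalso; apply: nLe0; rewrite -[e0](scalerK c0); apply: (subspaceZ sL).
  rewrite -(subKr x (c *: e0)).
  by apply: (subspaceB sL) => //; exact: NL.
- move=> y [c Lyc]; exists (y - c *: e0) => //=.
  by exists c; rewrite subKr subrr; exact: (subspace0 sN).
Qed.

Lemma has_dim_neq0 M N n : has_dim M N n -> ~ M `<=` N -> (0 < n)%N.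
Proof.
case: n => // -[e [_ _ span]] []; move=> x /span[c].
by rewrite big_ord0 subr0.
Qed.

Lemma decreasing_chain_stable (V : nat -> set X) N m :
  is_subspace N -> (forall j, is_subspace (V j)) -> (forall j, N `<=` V j) ->
  (forall i j, (i <= j)%N -> V j `<=` V i) -> has_dim (V 0%N) N m ->
  exists j0, forall j, V j0 `<=` V j.
Proof.
move=> sN; elim/ltn_ind: m V => m IH V sV NV decr dimV.
have [|/existsNP[j Vj]] := pselect (forall j, V 0%N `<=` V j); first by exists 0%N.
have [a [b [dima dimb abm]]] :=
  has_dim_split (sV 0%N) (sV j) sN (NV j) (decr _ _ (leq0n j)) dimV.
have a0 := has_dim_neq0 dima Vj.
have [|||||j0 j0P] := IH b _ (fun i => V (i + j)%N) => //.
- by rewrite -abm -[X in (X < _)%N]add0n ltn_add2r.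
- by move=> i k ik; apply: decr; rewrite leq_add2r.
exists (j0 + j)%N => k; have [jk|kj] := leqP j k.
  by rewrite -(subnK jk); exact: j0P.
by apply: decr; rewrite (leq_trans (ltnW kj)) // leq_addl.
Qed.

Lemma increasing_chain_stable (V : nat -> set X) M m :
  is_subspace M -> (forall j, is_subspace (V j)) -> (forall j, V j `<=` M) ->
  (forall i j, (i <= j)%N -> V i `<=` V j) -> has_dim M (V 0%N) m ->
  exists j0, forall j, V j `<=` V j0.
Proof.
move=> sM; elim/ltn_ind: m V => m IH V sV VM incr dimV.
have [|/existsNP[j Vj]] := pselect (forall j, V j `<=` V 0%N); first by exists 0%N.
have [a [b [dima dimb abm]]] :=
  has_dim_split sM (sV j) (sV 0%N) (incr _ _ (leq0n j)) (VM j) dimV.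
have b0 := has_dim_neq0 dimb Vj.
have [|||||j0 j0P] := IH a _ (fun i => V (i + j)%N) => //.
- by rewrite -abm -[X in (X < _)%N]addn0 ltn_add2l.
- by move=> i k ik; apply: incr; rewrite leq_add2r.
exists (j0 + j)%N => k; have [jk|kj] := leqP j k.
  by rewrite -(subnK jk); exact: j0P.
by apply: incr; rewrite (leq_trans (ltnW kj)) // leq_addl.
Qed.

(** ** Infima of sets of naturals *)

Lemma inf_nat_lty (A : set nat) : (inf_nat R A < +oo)%E <-> A !=set0.
Proof.
split=> [|[n An]].
  apply: contraPP => /set0P/negP; rewrite negbK => /eqP ->.
  by rewrite /inf_nat image_set0 ereal_inf0 ltxx.
by apply: le_lt_trans (ltry n%:R); apply: ereal_inf_lbound; exists n.
Qed.

Lemma inf_natP (A : set nat) n :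
  A n -> (forall m, A m -> (n <= m)%N) -> inf_nat R A = (n%:R)%:E.
Proof.
move=> An minn; apply/eqP; rewrite eq_le; apply/andP; split.
  by apply: ereal_inf_lbound; exists n.
by apply: le_ereal_inf_tmp => _ [m /minn nm <-]; rewrite lee_fin ler_nat.
Qed.

Lemma inf_nat_attained (A : set nat) : A !=set0 ->
  exists n, [/\ A n, forall m, A m -> (n <= m)%N & inf_nat R A = (n%:R)%:E].
Proof.
move=> [k Ak]; have exA : exists n, `[< A n >] by exists k; apply/asboolP.
exists (ex_minn exA); case: ex_minnP => n /asboolP An minn.
have min' m : A m -> (n <= m)%N by move=> Am; apply: minn; apply/asboolP.
by split=> //; exact: inf_natP.
Qed.

Lemma inf_nat_finite (A : set nat) n : inf_nat R A = (n%:R)%:E -> A n.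
Proof.
move=> An; have [|m [Am _]] := @inf_nat_attained A.
  by apply/inf_nat_lty; rewrite An ltry.
by rewrite An => -[/eqP]; rewrite eqr_nat => /eqP ->.
Qed.

Lemma qdim_lty M N : (qdim M N < +oo)%E <-> exists n, has_dim M N n.
Proof. exact: inf_nat_lty. Qed.

Lemma qdim_eq0 M N : is_subspace N -> qdim M N = 0%E <-> M `<=` N.
Proof.
move=> sN; split=> [/(@inf_nat_finite _ 0%N)[e [_ _ span]] x /span[c]|MN].
  by rewrite big_ord0 subr0.
by apply: (@inf_natP _ 0%N) => //; apply/has_dim_trivial.
Qed.

End Dimension.

(** * Iterates of an operator *)

Section Iterates.
Context {K : fieldType} {V : lmodType K}.

Lemma iter_linear n (S : {linear V -> V}) : linear (iter n S).
Proof. by elim: n => [//|n IH] a x y; rewrite !iterS IH linearP. Qed.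

HB.instance Definition _ n (S : {linear V -> V}) :=
  GRing.isLinear.Build K V V *:%R (iter n S) (iter_linear n S).

End Iterates.

(** * Perturbation series *)

Section Perturbation.
Context {R : realType} {V : normedModType R[i]}.
Variables (G : set (V * V)%type) (A : set V) (C : R).
Hypotheses (cV : series_complete V) (sG : is_subspace G) (cG : closed G).
Hypothesis solve : forall x, A x -> exists2 u, G (x, u) /\ A u & nrm u <= C * nrm x.

(** If G is solvable on A with constant C, the equation G (x0 + m u, u) has the
    solution u = sum of m^n x_(n+1), where x_(n+1) is a value of G at x_n. When G
    is the inverse of an operator S, this says S u - m u = x0. *)
Lemma perturbation (m : R[i]) x0 :
  0 <= C -> C * nrm (m : R[i]^o) <= 1 / 2 -> A x0 ->
  exists2 u, G (x0 + m *: u, u) & nrm u <= 2 * (C * nrm x0).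
Proof.
move=> C0 Cm Ax0.
have /choice[f fP] : forall x, exists u, A x ->
    [/\ G (x, u), A u & nrm u <= C * nrm x].
  move=> x; have [/solve[u [Gu Au] ux]|nA] := pselect (A x); last by exists 0.
  by exists u.
pose x n := iter n f x0.
have Ax n : A (x n) by elim: n => [//|n /fP[]].
have xP n := fP _ (Ax n).
pose z n := m ^+ n *: x n.
pose w n := m ^+ n *: x n.+1.
have wK n : nrm (w n) <= C * nrm x0 / 2 ^+ n.
  elim: n => [|n IH].
    by rewrite /w expr0 scale1r expr0 divr1; case: (xP 0%N).
  have -> : nrm (w n.+1) =
      nrm (m : R[i]^o) * (nrm (m ^+ n : R[i]^o) * nrm (x n.+2)).
    by rewrite /w exprS -scalerA !nrmZ.
  case: (xP n.+1) => _ _ xn.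
  apply: le_trans (_ : nrm (m : R[i]^o) * (C * nrm (w n)) <= _).
    rewrite ler_wpM2l ?nrm_ge0 // /w nrmZ mulrCA ler_wpM2l ?nrm_ge0 //.
  rewrite mulrA [nrm (m : R[i]^o) * C]mulrC.
  apply: le_trans (_ : 1 / 2 * nrm (w n) <= _).
    by rewrite ler_wpM2r ?nrm_ge0.
  rewrite exprS invfM; move: IH; set B := (2 ^+ n)^-1; lra.
have [u uP] := cV wK.
have u0 : nrm u <= 2 * (C * nrm x0).
  by have := uP 0%N; rewrite big_ord0 subr0 expr0 divr1.
exists u => //.
have sum_z n : \sum_(k < n.+1) z k = x0 + m *: \sum_(k < n) w k.
  rewrite big_ord_recl /z expr0 scale1r; congr (_ + _).
  rewrite scaler_sumr; apply: eq_bigr => i _.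
  by rewrite /w scalerA -exprS.
have zw n : G (\sum_(k < n) z k, \sum_(k < n) w k).
  elim: n => [|n IH]; first by rewrite !big_ord0; exact: (subspace0 sG).
  have Gn : G (x n, x n.+1) by case: (xP n).
  by rewrite !big_ord_recr; exact: (subspaceD sG IH (subspaceZ sG (m ^+ n) Gn)).
apply: (closed_adherent cG) => e e0.
pose M := nrm (m : R[i]^o).
have e'0 : 0 < e / (1 + M) by rewrite divr_gt0 // ltr_pwDl // nrm_ge0.
have [N NP] := pow_half_small (2 * (C * nrm x0)) e'0.
have close n : (N <= n)%N -> nrm (u - \sum_(k < n) w k) < e / (1 + M).
  by move=> /NP; exact: le_lt_trans.
exists (\sum_(k < N.+1) z k, \sum_(k < N.+1) w k) => //.
rewrite nrm_pair_lt sum_z /=; apply/andP; split.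
  rewrite opprD addrACA subrr add0r -scalerBr nrmZ -/M.
  apply: le_lt_trans (_ : M * (e / (1 + M)) < _).
    by rewrite ler_wpM2l ?nrm_ge0 // ltW // close.
  rewrite mulrA ltr_pdivrMr ?ltr_pwDl ?nrm_ge0 //; nra.
apply: lt_le_trans (close _ (leqnSn _)) _.
rewrite ler_pdivrMr ?ltr_pwDl ?nrm_ge0 //.
have := nrm_ge0 (m : R[i]^o); rewrite -/M; nra.
Qed.

End Perturbation.

(** * Regular descent and limits of invertible operators *)

Section Operators.
Context {R : realType} {X : completeNormedModType R[i]}.
Implicit Types (S : {linear X -> X}) (m : R[i]).

Let cX : series_complete X := @complete_series_complete R X.

Definition invertible_at (S : X -> X) m :=
  (forall x, S x = m *: x -> x = 0) /\ (forall y, exists x, S x - m *: x = y).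

Definition limit_of_invertible (S : X -> X) := forall e : R, 0 < e ->
  exists m, [/\ m != 0, nrm (m : R[i]^o) < e & invertible_at S m].

Lemma continuous_iter S n : continuous S -> continuous (iter n S).
Proof.
move=> cS; elim: n => [|n IH] x; first exact: cvg_id.
rewrite [iter n.+1 S](_ : _ = S \o iter n S) //.
by apply: continuous_comp; [exact: IH | exact: cS].
Qed.

Lemma subspace_range S n : is_subspace (range (iter n S)).
Proof. exact: (@subspace_image _ _ _ (iter n S) _ (subspaceT X)). Qed.

Lemma subspace_null S n : is_subspace (null_space (iter n S)).
Proof. exact: (@subspace_preimage _ _ _ (iter n S) _ (subspace_set0 X)). Qed.

Lemma closed_null S n : continuous S -> closed (null_space (iter n S)).
Proof.
move=> cS; apply: closed_continuous_preimage; first exact: continuous_iter.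
by apply: adherent_closed => x adx; apply: nrm_eq0; apply/eqP;
  rewrite eq_le nrm_ge0 andbT; apply/ler_addgt0Pl => e /adx[y ->];
  rewrite subr0 addr0; exact: ltW.
Qed.

Lemma range_decr S i j : (i <= j)%N -> range (iter j S) `<=` range (iter i S).
Proof.
by move=> /subnKC <- _ [x _ <-]; exists (iter (j - i) S x); rewrite // -iterD.
Qed.

Lemma null_incr S i j : (i <= j)%N ->
  null_space (iter i S) `<=` null_space (iter j S).
Proof. by move=> /subnK <- x /= Sx; rewrite /null_space /= iterD Sx linear0. Qed.

Definition graph_shift S d k :=
  [set p : X * X | iter d S p.1 = iter (d + k) S p.2].

(** This is the preimage under S^d of R(S^(d+k)), that is R(S^k) + N(S^d). It is
    closed in X if and only if R(S^(d+k)) is closed in R(S^d) for the norm of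
    X / N(S^d). *)
Definition lifted_range S d k := domain (graph_shift S d k).

Lemma lifted_rangeP S d k x :
  lifted_range S d k x <-> range (iter (d + k) S) (iter d S x).
Proof. by split=> [[u] /= Sx|[u _ Sx]]; exists u. Qed.

Lemma subspace_graph_shift S d k : is_subspace (graph_shift S d k).
Proof.
split; first by rewrite /graph_shift /= !linear0.
move=> a [x u] [y v]; rewrite /graph_shift /= => Sx Sy.
by rewrite !linearP /= Sx Sy.
Qed.

Lemma closed_graph_shift S d k : continuous S -> closed (graph_shift S d k).
Proof.
move=> cS; have -> : graph_shift S d k =
    (fun p : X * X => iter d S p.1 - iter (d + k) S p.2) @^-1`
      null_space (iter 0 S).
  apply/seteqP; split=> p; rewrite /graph_shift /null_space /= => /eqP.
    by rewrite -subr_eq0 => /eqP.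
  by rewrite subr_eq0 => /eqP.
apply: closed_continuous_preimage; last exact: closed_null.
move=> p; apply: cvgB.
  by apply: (@continuous_comp _ _ _ _ (iter d S));
    [exact: cvg_fst | exact: continuous_iter].
by apply: (@continuous_comp _ _ _ _ (iter (d + k) S));
  [exact: cvg_snd | exact: continuous_iter].
Qed.

Lemma subspace_lifted_range S d k : is_subspace (lifted_range S d k).
Proof. exact: subspace_domain (subspace_graph_shift _ _ _). Qed.

(** The operator induced by S on R(S^d), normed as X / N(S^d), is a Kato
    operator: the second condition says that its range R(S^(d+1)) is closed. *)
Definition regular_descent S d :=
  (forall n, (d <= n)%N -> range (iter d S) `&` null_space S `<=` range (iter n S))
  /\ closed (lifted_range S d 1).

Section Key.
Variables (S : {linear X -> X}) (d : nat).
Hypotheses (cS : continuous S) (rS : regular_descent S d).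
Hypothesis limS : limit_of_invertible S.

Lemma regular_descent_solve : exists2 C : R, 0 < C &
  forall x, lifted_range S d 1 x ->
  exists2 u, graph_shift S d 1 (x, u) & nrm u <= C * nrm x.
Proof.
apply: open_mapping => //; first exact: subspace_graph_shift.
  exact: closed_graph_shift.
by case: rS.
Qed.

(** Let y = S^d x0 be in the kernel of S. Since the kernel is contained in all
    ranges, every preimage of a point of the intersection of all ranges is again
    in this intersection, so y has an infinite sequence of iterated preimages. The
    perturbation series built from it is an eigenvector of S for m close to y if m
    is small; as S - m is injective for some small m, y = 0. *)
Lemma regular_descent_null : range (iter d S) `&` null_space S `<=` [set 0].
Proof.
have [C C0 CP] := regular_descent_solve.
pose A := [set x | forall n, range (iter n S) (iter d S x)].
have solve x : A x ->
    exists2 u, graph_shift S d 1 (x, u) /\ A u & nrm u <= C * nrm x.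
  move=> Ax; have [|u Gu ux] := CP x.
    by apply/lifted_rangeP; exact: Ax.
  exists u => //; split=> // n.
  suff : range (iter (maxn d n) S) (iter d S u).
    by apply: range_decr; exact: leq_maxr.
  set n' := maxn d n; have dn' : (d <= n')%N by exact: leq_maxl.
  have [v _ Sv] := Ax n'.+1.
  rewrite -(subrK (iter n' S v) (iter d S u)).
  apply: (subspaceD (subspace_range _ _)); last by exists v.
  apply: (rS.1 _ dn'); split.
    apply: (subspaceB (subspace_range _ _)); first by exists u.
    by apply: (range_decr dn'); exists v.
  move: Gu; rewrite /graph_shift /null_space /= => Gu.
  by rewrite linearB /= -!iterS Sv Gu addn1 subrr.
move=> _ [[x0 _ <-] Sx0].
have Ax0 : A x0.
  move=> n; suff : range (iter (maxn d n) S) (iter d S x0).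
    by apply: range_decr; exact: leq_maxr.
  by apply: rS.1; [exact: leq_maxl | split=> //; exists x0].
have [D D0 DP] := continuous_nrm (f := iter d S) (@continuous_iter S d cS).
apply: nrm_eq0; apply/eqP; rewrite eq_le nrm_ge0 andbT.
apply/ler_addgt0Pl => e e0; rewrite addr0.
pose B := D * (2 * (C * nrm x0)) + 1.
have B0 : 0 < B by rewrite ltr_wpDl // !mulr_ge0 ?nrm_ge0 ?ltW.
have [|m [m0 me [inj _]]] := limS (e := Num.min (1 / 2 / C) (e / B)).
  by rewrite lt_min !divr_gt0.
move: me; rewrite lt_min => /andP[mC mB].
have Cm : C * nrm (m : R[i]^o) <= 1 / 2 by rewrite mulrC -ler_pdivlMr // ltW.
have [u Gu ux] := perturbation cX (subspace_graph_shift S d 1)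
  (@closed_graph_shift S d 1 cS) solve (ltW C0) Cm Ax0.
have eig : iter d S (x0 + m *: u) = 0.
  apply: inj; rewrite -iterS iterSr.
  move: Gu; rewrite /graph_shift /= addn1 => Gu.
  rewrite -iterSr iterS [in LHS]linearD /= [in LHS]linearD /=.
  have -> : S (iter d S x0) = 0 by [].
  by rewrite add0r !linearZ /= -iterS -Gu.
have -> : iter d S x0 = - (m *: iter d S u).
  by apply/eqP; rewrite -addr_eq0 -linearZ -linearD /= eig.
rewrite nrmN nrmZ.
apply: le_trans (_ : nrm (m : R[i]^o) * B <= _).
  rewrite ler_wpM2l ?nrm_ge0 // (le_trans (DP u)) // /B.
  apply: le_trans (_ : D * (2 * (C * nrm x0)) <= _); last by rewrite lerDl.
  by rewrite ler_pM2l.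
by rewrite -ler_pdivlMr // ltW.
Qed.

(** Given x, solve (S - m) w = x. Then S^d (x + m y) is in R(S^(d+1)) for all y
    with S^d y = S^d w, and it remains to choose y bounded independently of m. As S
    is injective on R(S^d), any such y can be replaced by one with norm at most
    C |x| + |y| / 2; repeating this brings the norm below 2 C |x| + 1. *)
Lemma regular_descent_range : range (iter d S) `<=` range (iter d.+1 S).
Proof.
have [C C0 CP] := regular_descent_solve.
suff full x : lifted_range S d 1 x.
  by move=> _ [x _ <-]; have /lifted_rangeP := full x; rewrite addn1.
apply: closed_adherent rS.2 _ => e e0.
pose B := 2 * (C * nrm x) + 1.
have B0 : 0 < B by rewrite ltr_wpDl // !mulr_ge0 ?nrm_ge0 ?ltW.
have [|m [m0 me [_ surj]]] := limS (e := Num.min (1 / 2 / C) (e / B)).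
  by rewrite lt_min !divr_gt0.
move: me; rewrite lt_min => /andP[mC mB].
have [w wP] := surj x.
have M0 := nrm_ge0 (m : R[i]^o).
have Cm : C * nrm (m : R[i]^o) <= 1 / 2 by rewrite mulrC -ler_pdivlMr // ltW.
have lift y : iter d S y = iter d S w -> lifted_range S d 1 (x + m *: y).
  move=> yw; exists w; rewrite /graph_shift /= addn1.
  rewrite linearD linearZ /= yw -wP linearB linearZ /= subrK.
  by rewrite -iterSr.
have shrink k : exists2 y, iter d S y = iter d S w &
    nrm y <= 2 * (C * nrm x) + nrm w / 2 ^+ k.
  elim: k => [|k [y yw yn]].
    exists w => //; rewrite expr0 divr1 lerDr.
    by rewrite !mulr_ge0 ?nrm_ge0 ?ltW.
  have [u Gu un] := CP _ (lift y yw); exists u.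
    apply/eqP; rewrite -subr_eq0; apply/eqP/regular_descent_null; split.
      by apply: (subspaceB (subspace_range _ _)); [exists u | exists w].
    move: Gu; rewrite /graph_shift /null_space /= addn1 => Gu.
    rewrite linearB /= -!iterS -Gu linearD linearZ /= yw -wP linearB linearZ /=.
    by rewrite subrK -iterSr subrr.
  apply: (le_trans un); apply: le_trans (_ : C * nrm x + 1 / 2 * nrm y <= _).
    rewrite -[X in _ <= X]/(_ + _).
    apply: le_trans (_ : C * (nrm x + nrm (m : R[i]^o) * nrm y) <= _).
      by rewrite ler_pM2l // -nrmZ nrmD.
    by rewrite mulrDr lerD2l mulrA ler_wpM2r ?nrm_ge0.
  by rewrite exprS invfM; move: yn; set E := (2 ^+ k)^-1; lra.
have [N NP] := pow_half_small (nrm w) (e := 1) ltr01.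
have [y yw yn] := shrink N.
exists (x + m *: y); first exact: lift.
rewrite opprD addrA subrr add0r nrmN nrmZ.
apply: le_lt_trans (_ : nrm (m : R[i]^o) * B < _).
  rewrite ler_wpM2l // (le_trans yn) // /B lerD2l ltW //.
  exact: NP.
by rewrite -ltr_pdivlMr.
Qed.

Lemma Drazin_of_limit : Drazin S.
Proof.
split; apply/inf_nat_lty; exists d; apply/seteqP; split.
- exact: null_incr.
- by move=> x Sx; apply: regular_descent_null; split=> //; exists x.
- exact: regular_descent_range.
- exact: range_decr.
Qed.

End Key.
End Operators.

(** * Classes of operators with regular descent *)

Section Classes.
Context {R : realType} {X : completeNormedModType R[i]}.
Variables (S : {linear X -> X}).
Hypothesis cS : continuous S.

Let cX : series_complete X := @complete_series_complete R X.

Lemma subspace_null1 : is_subspace (null_space S).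
Proof. exact: (@subspace_preimage _ _ _ S _ (subspace_set0 X)). Qed.

Lemma subspace_null_range n : is_subspace (range (iter n S) `&` null_space S).
Proof. exact: subspaceI (subspace_range _ _) subspace_null1. Qed.

Lemma k_eq0 n : k_ n S = 0%E <->
  range (iter n S) `&` null_space S `<=` range (iter n.+1 S).
Proof.
rewrite (qdim_eq0 _ (subspace_null_range _)); split=> [kn x /kn[]//|kn x].
by move=> [Rx Nx]; split=> //; exact: kn.
Qed.

Lemma k_eq0_null_range d : (forall n, (d <= n)%N -> k_ n S = 0%E) ->
  forall n, (d <= n)%N -> range (iter d S) `&` null_space S `<=` range (iter n S).
Proof.
move=> kd n /subnKC <-; elim: (n - d)%N => [|j IH] x; first by rewrite addn0 => -[].
move=> xN; rewrite addnS; apply: (k_eq0 _).1 (kd _ (leq_addr _ _)) _ _.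
by split; [exact: IH | case: xN].
Qed.

Lemma closed_lifted_range d k : closed (range (iter (d + k) S)) ->
  closed (lifted_range S d k).
Proof.
move=> cR; have -> : lifted_range S d k = iter d S @^-1` range (iter (d + k) S).
  by apply/seteqP; split=> x /lifted_rangeP.
by apply: closed_continuous_preimage => //; exact: continuous_iter.
Qed.

Lemma quasi_Fredholm_regular : quasi_Fredholm S -> exists d, regular_descent S d.
Proof.
move=> [d [kd cR]]; exists d; split; first exact: k_eq0_null_range.
by apply: closed_lifted_range; rewrite addn1.
Qed.

Lemma range_norm_le d x : range_norm d S (iter d S x) <= nrm x.
Proof.
by apply: ge_inf; [exists 0 => _ [y _ <-]; exact: nrm_ge0 | exists x].
Qed.

Lemma TUD_regular : TUD S -> exists d, regular_descent S d.
Proof.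
move=> [d [kd cd]]; exists d; split; first exact: k_eq0_null_range.
apply: adherent_closed => x adx; apply/lifted_rangeP.
apply: (cd (d + 1)%N) => [||e e0]; [exact: leq_addr | by exists x|].
have [y /lifted_rangeP Ry xy] := adx _ e0; exists (iter d S y) => //.
by rewrite -linearB; apply: le_lt_trans xy; exact: range_norm_le.
Qed.

Lemma closed_in_closed (T : topologicalType) (M A : set T) : closed M -> A `<=` M ->
  closed (A : set (subspace M)) -> closed A.
Proof.
move=> cM AM /closed_subspaceP[B cB BM].
have -> : A = B `&` M by rewrite BM; apply/esym/setIidl.
exact: closedI.
Qed.

(** For a Kato operator the kernels of all powers are contained in the range:
    S^n x is in the kernel, so it is S^(n+1) w, and x - S w is in the kernel of
    S^n. *)
Lemma Kato_null_range (M : set X) : is_subspace M -> S @` M `<=` M ->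
  Kato_on M S -> forall n x, M x -> iter n S x = 0 -> (S @` M) x.
Proof.
move=> sM SM [_ KM]; elim=> [|n IH] x Mx.
  by move=> /= ->; exists 0; [exact: (subspace0 sM) | rewrite linear0].
move=> Sx; have Mn k y : M y -> M (iter k S y).
  by move=> My; elim: k => [//|k IHk]; apply: SM; exists (iter k S y).
have [w Mw Sw] : (iter n.+1 S @` M) (iter n S x).
  by apply: KM => //; split; [exact: Mn|].
have [|v Mv Sv] := IH (x - S w) (subspaceB sM Mx (SM _ (ex_intro2 _ _ w Mw erefl))).
  by rewrite linearB /= -iterSr Sw subrr.
exists (v + w); first exact: (subspaceD sM).
by rewrite linearD Sv subrK.
Qed.

(** For d the order of nilpotency of S on X1, all of R(S^d) lies in X2, and the
    lifted range is X1 + S(X2), closed because the projection onto X1 along X2 is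
    bounded. *)
Lemma Kato_type_regular : Kato_type S -> exists d, regular_descent S d.
Proof.
move=> [X1 [X2 [[s1 c1 S1] [s2 c2 S2] [cover direct] [d nil] Kato]]]; exists d.
have M2 k y : X2 y -> X2 (iter k S y).
  by move=> My; elim: k => [//|k IHk]; apply: S2; exists (iter k S y).
have iter_split k x1 x2 : X1 x1 -> iter (d + k) S (x1 + x2) = iter (d + k) S x2.
  move=> Xx; have Sx : iter (d + k) S x1 = 0 by rewrite addnC iterD nil // linear0.
  by rewrite linearD /= Sx add0r.
split.
  move=> n dn _ [[x _ <-] Nx]; have [x1 [x2 [Xx1 Xx2 xE]]] := cover x.
  move: Nx; rewrite xE -[d]addn0 iter_split // addn0 => Nx.
  case: n dn => [|n] dn; first by exists (iter d S x2).
  have [w Mw <-] : (iter n.+1 S @` X2) (iter d S x2).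
    by apply: Kato.2 => //; split=> //; exact: M2.
  by exists w.
pose G := [set p : X * X | X2 p.1 /\ p.1 - p.2 = 0].
have domG : domain G = X2.
  apply/seteqP; split=> x; first by case=> u [].
  by move=> Xx; exists x; split=> //=; rewrite subrr.
have sG : is_subspace G.
  split; first by split; [exact: (subspace0 s2) | rewrite /= subrr].
  move=> a [x u] [y v] [/= Xx /subr0_eq <-] [/= Xy /subr0_eq <-].
  by split; [exact: s2.2 | rewrite /= subrr].
have cG : closed G.
  apply: (@closedI _ [set p : X * X | X2 p.1] [set p : X * X | p.1 - p.2 = 0]).
    by apply: (closed_continuous_preimage (f := fst)) c2 => p; exact: cvg_fst.
  apply: (closed_continuous_preimage (f := fun p : X * X => p.1 - p.2))
    (@closed_null _ _ S 0 cS).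
  by move=> p; apply: cvgB; [exact: cvg_fst | exact: cvg_snd].
have cSX2 : closed (S @` X2) by apply: closed_in_closed Kato.1.
have -> : lifted_range S d 1 = [set x | exists2 v, X1 v & (S @` X2) (x - v)].
  apply/seteqP; split=> x.
    move=> [u Gu]; have [x1 [x2 [Xx1 Xx2 xE]]] := cover x.
    have [u1 [u2 [Xu1 Xu2 uE]]] := cover u; exists x1 => //.
    move: Gu; rewrite /graph_shift /= xE uE iter_split // -[in LHS](addn0 d).
    rewrite iter_split // addn0 addn1 iterSr => Gu.
    rewrite addrC addKr -(subrK (S u2) x2).
    apply: (subspaceD (subspace_image S s2)); last by exists u2.
    have SXu2 : X2 (S u2) by apply: S2; exists u2.
    apply: (Kato_null_range s2 S2 Kato (n := d)); first exact: (subspaceB s2).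
    by rewrite linearB /= Gu subrr.
  move=> [v Xv [w Xw Sw]]; exists w; rewrite /graph_shift /= -(subrK v x) -Sw addrC.
  by rewrite -[in LHS](addn0 d) iter_split // addn0 addn1 iterSr.
apply: (closed_complement_sum cX cX sG cG s1 c1) => //.
- move=> x; have [x1 [x2 [Xx1 Xx2 ->]]] := cover x; exists x1 => //.
  by rewrite domG addrC addKr.
- by rewrite domG => x X1x X2x; have : (X1 `&` X2) x by []; rewrite direct.
- exact: subspace_image.
- by rewrite domG.
Qed.

Lemma null_quotient_iso p m :
  has_dim (null_space (iter p.+1 S)) (null_space (iter p S)) m <->
  has_dim (range (iter p S) `&` null_space S) [set 0] m.
Proof.
apply: (has_dim_iso (f := iter p S)) => //; first exact: subspace_set0.
- by move=> _ [[x _ <-] Nx]; exists x => //; rewrite /= subrr.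
- exact: subspace_null.
Qed.

(** Inductively, suppose that Z = R(S^k) + N(S^p) is closed. Then so is its finite
    extension W = Z + N(S^(p+1)). A point x adherent to the next lifted range can
    be written S^p x = S^(p+1) w, and bounded solutions for the errors x - y show
    that w is adherent to W, so it is in W, whence S^p x is in R(S^(p+k+1)). *)
Lemma closed_lifted_ranges p m :
  has_dim (null_space (iter p.+1 S)) (null_space (iter p S)) m ->
  closed (lifted_range S p 1) -> forall k, closed (lifted_range S p k).
Proof.
move=> [f [Nf _ spanf]] c1; elim=> [|k IH].
  rewrite (_ : lifted_range S p 0 = setT); first exact: closedT.
  by apply/seteqP; split=> // x _; exists x; rewrite /graph_shift /= addn0.
have [C C0 CP] := open_mapping cX cX (subspace_graph_shift S p 1)
  (@closed_graph_shift _ _ S p 1 cS) c1.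
have sZ j := subspace_lifted_range S p j.
pose W := add_span (lifted_range S p k) f.
have sW : is_subspace W by exact: subspace_add_span.
have cW : closed W by exact: closed_add_span.
have ZW x : lifted_range S p k x -> W x.
  by move=> Zx; exists (fun=> 0); rewrite big1 ?subr0 // => i _; rewrite scale0r.
have NW x : null_space (iter p.+1 S) x -> W x.
  move=> /spanf[c Nc]; exists c; exists 0.
  by rewrite /graph_shift /= linear0; exact: Nc.
have Z1 : lifted_range S p k.+1 `<=` lifted_range S p 1.
  move=> x /lifted_rangeP Rx; apply/lifted_rangeP; apply: range_decr Rx.
  by rewrite leq_add2l.
apply: adherent_closed => x adx.
have [w Gw] : lifted_range S p 1 x.
  by apply: closed_adherent c1 _ => e /adx[y /Z1]; exists y.
have Ww : W w.
  apply: closed_adherent cW _ => e e0.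
  have eC : 0 < e / C by rewrite divr_gt0.
  have [y Zy xy] := adx _ eC.
  have [|v Gv vx] := CP (x - y).
    by apply: (subspaceB (sZ 1%N)); [exists w | exact: Z1].
  exists (w - v).
    have [u Gu] := Zy; rewrite -(subrK (iter k S u) (w - v)).
    apply: (subspaceD sW).
      apply: NW; move: Gw Gv Gu; rewrite /graph_shift => /= Gw Gv Gu.
      change (iter p.+1 S (w - v - iter k S u) = 0).
      rewrite -addn1 linearB /= linearB /= -iterD -addnA add1n.
      by rewrite -Gw -Gv -Gu linearB /= subKr subrr.
    by apply: ZW; exists u; rewrite /graph_shift /= iterD.
  rewrite opprB addrC subrK; apply: (le_lt_trans vx).
  by rewrite mulrC -ltr_pdivlMr.
have [c [u Gu]] := Ww; exists u; rewrite /graph_shift /= addnS iterS.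
have fS : S (iter p S (\sum_i c i *: f i)) = 0.
  rewrite 2!linear_comb big1 // => i _.
  by rewrite (Nf i : S (iter p S (f i)) = 0) scaler0.
move: Gw Gu; rewrite /graph_shift /= addn1 => -> <-.
by rewrite linearB /= linearB /= fS subr0.
Qed.

(** S^p identifies N(S^(p+1)) / N(S^p) with the intersection of N(S) and R(S^p).
    It is finite-dimensional, so the intersections of N(S) with R(S^n), n >= p,
    become constant. *)
Lemma finite_null_quotient_regular p m :
  has_dim (null_space (iter p.+1 S)) (null_space (iter p S)) m ->
  closed (lifted_range S p 1) -> exists d, regular_descent S d.
Proof.
move=> dimN c1; have cZ := closed_lifted_ranges dimN c1.
have [j0 j0P] : exists j0, forall j,
    range (iter (j0 + p) S) `&` null_space S `<=`
    range (iter (j + p) S) `&` null_space S.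
  apply: (@decreasing_chain_stable _ _
    (fun j => range (iter (j + p) S) `&` null_space S) [set 0] m).
  - exact: subspace_set0.
  - by move=> j; exact: subspace_null_range.
  - by move=> j _ ->; exact: (subspace0 (subspace_null_range _)).
  - move=> i j ij x [Rx Nx]; split=> //; apply: range_decr Rx.
    by rewrite leq_add2r.
  - exact/null_quotient_iso.
exists (j0 + p)%N; split=> [n dn x /j0P|].
  move=> /(_ n)[Rx _]; apply: range_decr Rx; exact: leq_addr.
have -> : lifted_range S (j0 + p) 1 = iter j0 S @^-1` lifted_range S p (j0 + 1).
  have E x : iter p S (iter j0 S x) = iter (j0 + p) S x by rewrite -iterD addnC.
  have En : (p + (j0 + 1) = j0 + p + 1)%N by rewrite addnA (addnC p).
  by apply/seteqP; split=> x [u Gu]; exists u; move: Gu;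
    rewrite /graph_shift /= E En.
apply: closed_continuous_preimage => //; exact: continuous_iter.
Qed.

Lemma range_quotient_iso q m :
  has_dim (range (iter q S)) (range (iter q.+1 S)) m <->
  has_dim [set: X] (lifted_range S q 1) m.
Proof.
apply: iff_sym; apply: (has_dim_iso (f := iter q S)) => //.
- exact: subspace_range.
- by move=> x _; rewrite -[q.+1]addn1; apply: iff_sym; exact: lifted_rangeP.
- move=> _ [x _ <-]; exists x => //; rewrite subrr.
  exact: (subspace0 (subspace_range _ _)).
Qed.

(** S^q identifies X / (R(S) + N(S^q)) with R(S^q) / R(S^(q+1)). The subspaces
    R(S) + N(S^n), n >= q, have finite codimension and increase, so they become
    constant; an operator range of finite codimension is closed, and constancy
    means that N(S) & R(S^n) no longer decreases. *)
Lemma finite_range_quotient_regular q m :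
  has_dim (range (iter q S)) (range (iter q.+1 S)) m ->
  exists d, regular_descent S d.
Proof.
move=> /range_quotient_iso dimX.
pose V j := lifted_range S (j + q) 1.
have sV j : is_subspace (V j) by exact: subspace_lifted_range.
have incrV i j : (i <= j)%N -> V i `<=` V j.
  move=> ij x [u Gu]; exists u; move: Gu; rewrite /graph_shift /= !addn1 => Gu.
  rewrite -(subnK ij) -addnA iterD Gu -iterD.
  by rewrite addnS addnA.
have [j0 j0P] : exists j0, forall j, V j `<=` V j0.
  exact: (increasing_chain_stable (M := [set: X]) (m := m)).
exists (j0 + q)%N; split.
  move=> n /subnKC <- x [Rx Nx].
  elim: (n - _)%N => [|j [z _ zx]]; first by rewrite addn0.
  have [u Gu] : V (j0 + j)%N z.
    apply: (incrV j0); first exact: leq_addr.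
    apply: (j0P (j0 + j).+1); exists 0.
    by rewrite /graph_shift /= !linear0 -[RHS]Nx -zx addnAC -iterS.
  exists u => //; rewrite -zx; move: Gu; rewrite /graph_shift /= addn1 addnS.
  by rewrite addnAC => <-.
have [a [b [[e [_ free span]] _ _]]] :=
  has_dim_split (subspaceT X) (sV j0) (sV 0%N) (incrV _ _ (leq0n _))
    (@subsetT _ _) dimX.
apply: (@complemented_domain_closed _ _ _ _ (add_span [set 0] e)) => //.
- exact: subspace_graph_shift.
- exact: closed_graph_shift.
- exact/subspace_add_span/subspace_set0.
- apply: closed_add_span; first exact: subspace_set0.
  exact: (@closed_null _ _ S 0 cS).
- move=> x; have [c Vc] := span x I; exists (\sum_i c i *: e i) => //.
  by exists c; rewrite /= subrr.
- move=> x [c /= /subr0_eq ->] Vx; rewrite big1 // => i _.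
  by rewrite (free c) // scale0r.
Qed.

End Classes.

(** * Drazin invertible operators *)

Section DrazinDecomposition.
Context {R : realType} {X : completeNormedModType R[i]}.
Variable S : {linear X -> X}.

Let cX : series_complete X := @complete_series_complete R X.

Lemma null_stable p : null_space (iter p.+1 S) `<=` null_space (iter p S) ->
  forall n, null_space (iter n S) `<=` null_space (iter p S).
Proof.
move=> Np n; suff : null_space (iter (p + n) S) `<=` null_space (iter p S).
  by apply: subset_trans; apply: null_incr; exact: leq_addl.
elim: n => [|n IH] x; first by rewrite addn0.
move=> Nx; apply: IH; rewrite /null_space /= iterD; apply: Np.
by move: Nx; rewrite /null_space /= -addSnnS iterD.
Qed.

Lemma range_stable p : range (iter p S) `<=` range (iter p.+1 S) ->
  forall n, range (iter p S) `<=` range (iter n S).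
Proof.
move=> Rp n; suff : range (iter p S) `<=` range (iter (n + p) S).
  by move/subset_trans; apply; apply: range_decr; exact: leq_addr.
elim: n => [//|n IH] x /IH [y _ <-].
have [|z _ zy] := Rp (iter p S y); first by exists y.
by exists z; rewrite // addSnnS iterD zy -iterD.
Qed.

Definition Drazin_index p :=
  null_space (iter p.+1 S) `<=` null_space (iter p S) /\
  range (iter p S) `<=` range (iter p.+1 S).

(** The ascent and the descent coincide when both are finite: at the index where
    one chain stops, stability of the other chain at its own index stops it too. *)
Lemma Drazin_ascent_descent : Drazin S ->
  exists p, [/\ Drazin_index p, ascent S = (p%:R)%:E & descent S = (p%:R)%:E].
Proof.
move=> [/inf_nat_lty/(@inf_nat_attained R) [a [Na mina aE]]].
move=> /inf_nat_lty/(@inf_nat_attained R) [d [Rd mind dE]].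
have Na' : null_space (iter a.+1 S) `<=` null_space (iter a S).
  by rewrite [X in _ `<=` X]Na.
have Rd' : range (iter d S) `<=` range (iter d.+1 S).
  by rewrite [X in X `<=` _]Rd.
have ad : (a <= d)%N.
  apply: mina; apply/seteqP; split; first exact: null_incr.
  move=> x Sx; have [z _ Sz] : range (iter a S) (iter d S x).
    by apply: (range_stable Rd'); exists x.
  rewrite /null_space /= -Sz; apply: (Na' z).
  by rewrite /null_space /= Sz; exact: Sx.
have da : (d <= a)%N.
  apply: mind; apply/seteqP; split; last exact: range_decr.
  move=> _ [x _ <-]; have [z _ Sz] : range (iter d.+1 S) (iter d S x).
    by apply: Rd'; exists x.
  exists z => //; apply/eqP; rewrite -subr_eq0 iterSr -linearB; apply/eqP.
  apply: (null_stable Na' (n := d)).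
  by rewrite /null_space /= linearB /= -iterSr Sz subrr.
have E : a = d by apply/eqP; rewrite eqn_leq ad da.
by exists a; split=> //; [split=> //; rewrite E | rewrite E].
Qed.

Section Decomposition.
Variable p : nat.
Hypotheses (cS : continuous S) (Dp : Drazin_index p).

Lemma Drazin_range_eq n : (p <= n)%N -> range (iter n S) = range (iter p S).
Proof.
by move=> pn; apply/seteqP; split; [exact: range_decr | exact: range_stable Dp.2 _].
Qed.

Lemma Drazin_direct n x : null_space (iter n S) x -> range (iter p S) x -> x = 0.
Proof.
move=> Nx [z _ Sz]; rewrite -Sz; apply: (null_stable Dp.1 (n := n + p)).
by rewrite /null_space /= iterD Sz.
Qed.

Lemma Drazin_null0 x : range (iter p S) x -> null_space S x -> x = 0.
Proof. by move=> Rx Nx; apply: (@Drazin_direct 1). Qed.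

Lemma Drazin_cover x :
  exists2 v, null_space (iter p S) v & range (iter p S) (x - v).
Proof.
have [z _ Sz] : range (iter (p + p) S) (iter p S x).
  by apply: (range_stable Dp.2); exists x.
exists (x - iter p S z); last by exists z; rewrite // subKr.
by rewrite /null_space /= linearB /= -Sz iterD subrr.
Qed.

Lemma Drazin_closed_range : closed (range (iter p S)).
Proof.
have <- : lifted_range S 0 p = range (iter p S).
  by apply/seteqP; split=> x; [move/lifted_rangeP | move=> Rx; apply/lifted_rangeP].
apply: (complemented_domain_closed cX cX (E := null_space (iter p S))).
- exact: subspace_graph_shift.
- exact: closed_graph_shift.
- exact: subspace_null.
- exact: closed_null.
- move=> x; have [v Nv Rv] := Drazin_cover x; exists v => //.
  exact/lifted_rangeP.
- by move=> x Nx /lifted_rangeP; exact: Drazin_direct Nx.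
Qed.

(** If z' solves the equation for S v, then z = (z' - v) / m solves it for v. *)
Lemma nilpotent_shift_surjective (m : R[i]) n v : m != 0 ->
  iter n S v = 0 -> exists z, S z - m *: z = v.
Proof.
move=> m0; elim: n v => [|n IH] v.
  by move=> /= ->; exists 0; rewrite linear0 scaler0 subrr.
rewrite iterSr => /IH[z Sz]; exists (m^-1 *: (z - v)).
rewrite linearZ /= linearB /= -Sz subKr !scalerA mulVf // mulfV //.
by rewrite !scale1r subKr.
Qed.

(** Apply [perturbation] to the inverse of the restriction of S to R(S^p), a closed
    relation. On N(S^p), where S is nilpotent, S - m is surjective for every
    m <> 0, and an eigenvector for m <> 0 is in R(S^p). *)
Lemma Drazin_punctured : exists2 e : R, 0 < e &
  forall m, m != 0 -> nrm (m : R[i]^o) < e -> invertible_at S m.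
Proof.
pose H := [set q : X * X | range (iter p S) q.2 /\ graph_shift S 0 1 q].
have sH : is_subspace H.
  split.
    by split; [exact: (subspace0 (subspace_range _ _)) |
      exact: (subspace0 (subspace_graph_shift _ _ _))].
  move=> a x y [Rx Gx] [Ry Gy].
  by split; [exact: (subspace_range _ _).2 |
    exact: (subspace_graph_shift _ _ _).2].
have cH : closed H.
  apply: (@closedI _ [set q : X * X | range (iter p S) q.2] (graph_shift S 0 1)).
    apply: (closed_continuous_preimage (f := snd)) Drazin_closed_range.
    by move=> q; exact: cvg_snd.
  exact: closed_graph_shift.
have HE x u : H (x, u) <-> range (iter p S) u /\ x = S u by [].
have domH : domain H = range (iter p S).
  apply/seteqP; split=> [x [u /HE[[z _ <-] ->]]|x Rx].
    by exists (S z); rewrite // -iterSr.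
  have [z _ <-] := Dp.2 _ Rx; exists (iter p S z).
  by apply/HE; split=> //; exists z.
have cdH : closed (domain H) by rewrite domH; exact: Drazin_closed_range.
have [C C0 CP] := open_mapping cX cX sH cH cdH.
have solve x : range (iter p S) x ->
    exists2 u, H (x, u) /\ range (iter p S) u & nrm u <= C * nrm x.
  rewrite -domH => /CP[u Hu ux]; exists u => //; split=> //.
  by rewrite domH; case: Hu.
exists (1 / 2 / C); first by rewrite !divr_gt0.
move=> m m0 mC; have Cm : C * nrm (m : R[i]^o) <= 1 / 2.
  by rewrite mulrC -ler_pdivlMr // ltW.
split=> [x Sx|y].
  have iterm n : iter n S x = m ^+ n *: x.
    elim: n => [|n IH]; first by rewrite expr0 scale1r.
    by rewrite iterS IH linearZ /= Sx scalerA exprSr.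
  have Rx : range (iter p S) x.
    exists (m ^- p *: x); rewrite // linearZ /= iterm scalerA.
    by rewrite mulVf ?expf_neq0 // scale1r.
  have [|u [/HE[Ru Su] _] ux] := solve (S x).
    by rewrite Sx; exact: (subspaceZ (subspace_range _ _)).
  have xu : x = u.
    apply/eqP; rewrite -subr_eq0; apply/eqP/Drazin_null0.
      exact: (subspaceB (subspace_range _ _)).
    by rewrite /null_space /= linearB /= Su subrr.
  move: ux; rewrite -xu Sx nrmZ mulrA => xx.
  apply: nrm_eq0; apply/eqP; rewrite eq_le nrm_ge0 andbT.
  have := ler_wpM2r (nrm_ge0 x) Cm; move: xx; have := nrm_ge0 x; lra.
have [v Nv Rv] := Drazin_cover y.
have [z Sz] := nilpotent_shift_surjective m0 Nv.
have [u /HE[_ Su] _] := perturbation cX sH cH solve (ltW C0) Cm Rv.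
exists (z + u); rewrite linearD scalerDr opprD addrACA /= Sz -Su addrK.
by rewrite addrC subrK.
Qed.

End Decomposition.
End DrazinDecomposition.

(** * Drazin invertible operators belong to every class *)

Section DrazinClasses.
Context {R : realType} {X : completeNormedModType R[i]}.
Variable S : {linear X -> X}.

Let null_range n := range (iter n S) `&` null_space S.

Lemma image_range n : S @` range (iter n S) = range (iter n.+1 S).
Proof.
apply/seteqP; split=> [_ [_ [x _ <-] <-]|_ [x _ <-]]; first by exists x.
by exists (iter n S x) => //; exists x.
Qed.

(** Let Q = R(S^(n+1)) + (N(S) & R(S^n)). The nullity of S on R(S^n) exceeds that
    on R(S^(n+1)) by the dimension of Q / R(S^(n+1)). So does the defect, because
    S induces an isomorphism from R(S^n) / Q onto R(S^(n+1)) / R(S^(n+2)). *)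
Lemma null_range_defect_step n :
  (forall m, has_dim (null_range n.+1) [set 0] m <->
             has_dim (range (iter n.+1 S)) (range (iter n.+2 S)) m) ->
  forall m, has_dim (null_range n) [set 0] m <->
            has_dim (range (iter n S)) (range (iter n.+1 S)) m.
Proof.
move=> IH m.
pose Q := [set x | exists2 y, null_range n y & range (iter n.+1 S) (x - y)].
have sR j := subspace_range S j; have sN j := subspace_null_range S j.
have sQ : is_subspace Q.
  split.
    by exists 0; rewrite ?subr0;
      [exact: (subspace0 (sN n)) | exact: (subspace0 (sR n.+1))].
  move=> a x y [v Nv Rv] [w Nw Rw]; exists (a *: v + w); first exact: (sN n).2.
  have -> : a *: x + y - (a *: v + w) = a *: (x - v) + (y - w).
    by rewrite scalerBr opprD addrACA.
  exact: (sR n.+1).2.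
have RQ : range (iter n.+1 S) `<=` Q.
  by move=> x Rx; exists 0; rewrite ?subr0 //; exact: (subspace0 (sN n)).
have QR : Q `<=` range (iter n S).
  move=> x [y [Ry _] Rxy]; rewrite -(subrK y x); apply: (subspaceD (sR n)) => //.
  exact: range_decr Rxy.
have NN : null_range n.+1 `<=` null_range n.
  by move=> x [Rx Nx]; split=> //; exact: range_decr Rx.
have N0 : [set 0] `<=` null_range n.+1 by move=> _ ->; exact: (subspace0 (sN _)).
have kernel k : has_dim (null_range n) (null_range n.+1) k <->
    has_dim Q (range (iter n.+1 S)) k.
  apply: (has_dim_iso (f := idfun)) => //.
  - by move=> x Nx; exists x => //; rewrite subrr; exact: (subspace0 (sR n.+1)).
  - by move=> x [Rx Nx]; split=> [Rx'|[]].
  - exact: sN.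
have quotient k : has_dim (range (iter n S)) Q k <->
    has_dim (range (iter n.+1 S)) (range (iter n.+2 S)) k.
  apply: (has_dim_iso (f := S)) => //.
  - by move=> _ [x _ <-]; exists x.
  - move=> x Rx; split=> [[z _ Sz]|[y [_ Ny] [z _ Sz]]].
      exists (x - iter n.+1 S z); last by exists z; rewrite // subKr.
      split; last by rewrite /null_space /= linearB /= -Sz /= subrr.
      apply: (subspaceB (sR n)) => //.
      exact: (range_decr (leqnSn n) (ex_intro2 _ _ z I erefl)).
    exists z => //; rewrite iterS Sz linearB /=.
    by rewrite [S y]Ny subr0.
  - move=> _ [x _ <-]; exists (iter n S x); first by exists x.
    by rewrite subrr; exact: (subspace0 (sR _)).
have s0 := subspace_set0 X.
split=> [/(has_dim_split (sN n) (sN n.+1) s0 N0 NN)|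
         /(has_dim_split (sR n) sQ (sR n.+1) RQ QR)] [a [b [da db <-]]].
  rewrite addnC; apply: (has_dim_add (sR n) sQ (sR n.+1) RQ QR).
    by apply/quotient/IH.
  exact/kernel.
rewrite addnC; apply: (has_dim_add (sN n) (sN n.+1) s0 N0 NN).
  exact/kernel.
by apply/IH/quotient.
Qed.

Section Fixed.
Variable p : nat.
Hypotheses (cS : continuous S) (Dp : Drazin_index S p).
Hypotheses (ascS : ascent S = (p%:R)%:E) (dscS : descent S = (p%:R)%:E).

(** Both vanish for n >= p, and [null_range_defect_step] descends from p to any
    smaller n. *)
Lemma Drazin_nullity_defect n m : has_dim (null_range n) [set 0] m <->
  has_dim (range (iter n S)) (range (iter n.+1 S)) m.
Proof.
have high k : (p <= k)%N -> forall m, has_dim (null_range k) [set 0] m <->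
    has_dim (range (iter k S)) (range (iter k.+1 S)) m.
  move=> pk j; have Rk : range (iter k S) `<=` range (iter k.+1 S).
    by rewrite !(Drazin_range_eq Dp) // leqW.
  have Nk : null_range k `<=` [set 0].
    move=> x [Rx Nx]; apply: (Drazin_null0 Dp) => //.
    by rewrite -(Drazin_range_eq Dp pk).
  have H1 := has_dim_trivial j Nk (subspace_set0 X).
  have H2 := has_dim_trivial j Rk (subspace_range S k.+1).
  exact: iff_trans H1 (iff_sym H2).
have [|np] := leqP p n; first by move/high; apply.
move: m; rewrite -(subKn (ltnW np)); elim: (p - n)%N => [|j IH].
  by rewrite subn0; exact: high.
have [pj|jp] := leqP p j.
  by move: IH; rewrite (eqP pj) (eqP (leqW pj)).
by apply: null_range_defect_step; rewrite subnSK.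
Qed.

Lemma Drazin_alpha_beta n :
  alpha_on (range (iter n S)) S = beta_on (range (iter n S)) S.
Proof.
rewrite /alpha_on /beta_on image_range /qdim; congr inf_nat.
by apply/seteqP; split=> m /Drazin_nullity_defect.
Qed.

Lemma range_closed_on : closed_range_on (range (iter p S)) S.
Proof.
rewrite /closed_range_on image_range (Drazin_range_eq Dp (leqnSn p)).
by apply: closed_subspaceW; exact: (Drazin_closed_range cS Dp).
Qed.

Lemma Drazin_alpha0 : alpha_on (range (iter p S)) S = 0%E.
Proof.
apply/(qdim_eq0 _ (subspace_set0 X)) => x [Rx Nx].
exact: (Drazin_null0 Dp).
Qed.

Lemma Drazin_B_Fredholm : B_Fredholm S.
Proof.
exists p; split; first exact: (Drazin_closed_range cS Dp).
split; last by rewrite /lower_semi_Fredholm_on -Drazin_alpha_beta Drazin_alpha0.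
by split; [rewrite Drazin_alpha0 | exact: range_closed_on].
Qed.

(** The index is computed at an arbitrary admissible n, where nullity and defect
    agree and one of them, hence both, is finite. *)
Lemma Drazin_B_index : B_index S = 0%E.
Proof.
rewrite /B_index; set P := [set n | _ /\ _]; set n := xget 0%N P.
have [_ fin] : P n.
  apply: (xgetPex 0%N); have [j [cj [uj lj]]] := Drazin_B_Fredholm.
  by exists j; split=> //; left.
rewrite /index_on Drazin_alpha_beta.
have /inf_nat_lty/(@inf_nat_attained R)[m [_ _ mE]] :
    (beta_on (range (iter n S)) S < +oo)%E.
  by case: fin => [[]|//]; rewrite Drazin_alpha_beta.
by rewrite [beta_on _ _]mE subee.
Qed.

Lemma Drazin_B_Weyl : B_Weyl S.
Proof. by split; [exact: Drazin_B_Fredholm | exact: Drazin_B_index]. Qed.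

Lemma Drazin_upper_semi_B_Weyl : upper_semi_B_Weyl S.
Proof.
split; last by rewrite Drazin_B_index.
by have [n [? []]] := Drazin_B_Fredholm; exists n.
Qed.

Lemma Drazin_lower_semi_B_Weyl : lower_semi_B_Weyl S.
Proof.
split; last by rewrite Drazin_B_index.
by have [n [? []]] := Drazin_B_Fredholm; exists n.
Qed.

Lemma Drazin_k_eq0 n : (p <= n)%N -> k_ n S = 0%E.
Proof.
move=> pn; apply/k_eq0 => x [Rx _].
by rewrite (Drazin_range_eq Dp) ?leqW // -(Drazin_range_eq Dp pn).
Qed.

Lemma Drazin_quasi_Fredholm : quasi_Fredholm S.
Proof.
exists p; split; first exact: Drazin_k_eq0.
by rewrite (Drazin_range_eq Dp (leqnSn p)); exact: (Drazin_closed_range cS Dp).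
Qed.

Lemma Drazin_TUD : TUD S.
Proof.
exists p; split; first exact: Drazin_k_eq0.
by move=> n pn y Ry _; rewrite (Drazin_range_eq Dp).
Qed.

Lemma Drazin_Kato_type : Kato_type S.
Proof.
exists (null_space (iter p S)), (range (iter p S)); split.
- split; [exact: subspace_null | exact: closed_null |].
  move=> _ [x Nx <-].
  by rewrite /null_space /= -iterSr iterS [iter p S x]Nx linear0.
- split; [exact: subspace_range | exact: (Drazin_closed_range cS Dp) |].
  by rewrite image_range; exact: range_decr.
- split; last first.
    apply/seteqP; split=> [x [Nx Rx]|_ ->]; first exact: (Drazin_direct Dp Nx Rx).
    by split; [exact: (subspace0 (subspace_null _ _)) |
      exact: (subspace0 (subspace_range _ _))].
  move=> x; have [v Nv Rv] := Drazin_cover Dp x; exists v, (x - v).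
  by split; rewrite // addrC subrK.
- by exists p.
split; first exact: range_closed_on.
move=> n _ x [Rx Nx]; rewrite (Drazin_null0 Dp Rx Nx).
by exists 0; [exact: (subspace0 (subspace_range _ _)) | rewrite linear0].
Qed.

Lemma Drazin_left : left_Drazin S.
Proof.
exists p; split=> //; rewrite (Drazin_range_eq Dp (leqnSn p)).
exact: (Drazin_closed_range cS Dp).
Qed.

Lemma Drazin_right : right_Drazin S.
Proof. by exists p; split=> //; exact: (Drazin_closed_range cS Dp). Qed.

Lemma Drazin_fin_descent : fin_descent S.
Proof. by rewrite /fin_descent dscS ltry. Qed.

(** Below p, where the range is closed, each R(S^j) is an extension of R(S^(j+1))
    by the span of the images of a fixed finite family, so closedness descends
    from p to q. This matters because the essential ascent and descent can be
    smaller than p. *)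
Lemma Drazin_closed_ranges q m :
  has_dim (range (iter q S)) (range (iter q.+1 S)) m ->
  forall j, (q <= j)%N -> closed (range (iter j S)).
Proof.
move=> [e [Re _ spane]].
have sR j := subspace_range S j.
have step j : (q <= j)%N ->
    closed (range (iter j.+1 S)) -> closed (range (iter j S)).
  move=> qj cj; pose f i := iter (j - q) S (e i).
  have Rf i : range (iter j S) (f i).
    by have [y _ Sy] := Re i; exists y; rewrite // /f -Sy -iterD subnK.
  have -> : range (iter j S) = add_span (range (iter j.+1 S)) f.
    apply/seteqP; split=> [_ [x _ <-]|x [c Rc]].
      have [c [z _ Sz]] : add_span (range (iter q.+1 S)) e (iter q S x).
        by apply: spane; exists x.
      exists c, z => //; rewrite -(linear_comb (iter (j - q) S)).
      have -> : iter j S x = iter (j - q) S (iter q S x) by rewrite -iterD subnK.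
      by rewrite -linearB -Sz -[RHS]iterD addnS subnK.
    rewrite -(subrK (\sum_i c i *: f i) x); apply: (subspaceD (sR j)).
      exact: range_decr Rc.
    by apply: (subspace_sum (sR j)) => i; exact: (subspaceZ (sR j)).
  exact: closed_add_span.
have down i : (i <= p - q)%N -> closed (range (iter (p - i) S)).
  elim: i => [|i IH] ipq.
    by rewrite subn0; exact: (Drazin_closed_range cS Dp).
  have ip : (i < p)%N by exact: leq_trans ipq (leq_subr _ _).
  apply: step; first lia.
  by rewrite subnSK //; apply: IH; exact: ltnW.
move=> j qj; have [pj|/ltnW jp] := leqP p j.
  by rewrite (Drazin_range_eq Dp pj); exact: (Drazin_closed_range cS Dp).
by rewrite -(subKn jp); apply: down; exact: leq_sub2l.
Qed.

Lemma ess_descent_set : (qdim (range (iter p S)) (range (iter p.+1 S)) < +oo)%E.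
Proof.
rewrite (_ : qdim _ _ = 0%E) ?ltry //; apply/(qdim_eq0 _ (subspace_range _ _)).
exact: Dp.2.
Qed.

Lemma Drazin_right_ess : right_ess_Drazin S.
Proof.
have [|q [/qdim_lty[m dimq] _ qE]] := @inf_nat_attained R
  [set n | (qdim (range (iter n S)) (range (iter n.+1 S)) < +oo)%E].
  by exists p; exact: ess_descent_set.
by exists q; split=> //; apply: (Drazin_closed_ranges dimq).
Qed.

Lemma Drazin_fin_ess_descent : fin_ess_descent S.
Proof. by apply/inf_nat_lty; exists p; exact: ess_descent_set. Qed.

Lemma Drazin_left_ess : left_ess_Drazin S.
Proof.
have [|q [/qdim_lty[m dimq] _ qE]] := @inf_nat_attained R
  [set n | (qdim (null_space (iter n.+1 S)) (null_space (iter n S)) < +oo)%E].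
  exists p => /=; rewrite (_ : qdim _ _ = 0%E) ?ltry //.
  by apply/(qdim_eq0 _ (subspace_null _ _)); exact: Dp.1.
exists q; split=> //; apply: (@Drazin_closed_ranges q m) => //.
by apply/Drazin_nullity_defect; apply/null_quotient_iso.
Qed.

End Fixed.
End DrazinClasses.

(** * Connectedness of the complement of the spectrum *)

Section Shift.
Context {K : fieldType} {V : lmodType K}.

Definition shift (T : V -> V) l x := T x - l *: x.

Lemma shift_linear (T : {linear V -> V}) l : linear (shift T l).
Proof.
move=> a x y; rewrite /shift linearP scalerDr scalerBr opprD addrACA.
by rewrite !scalerA [l * a]mulrC.
Qed.

HB.instance Definition _ (T : {linear V -> V}) l :=
  GRing.isLinear.Build K V V *:%R (shift T l) (shift_linear T l).

End Shift.

Section ConnectedResolvent.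
Context {R : realType} {X : completeNormedModType R[i]}.
Implicit Types (S T : {linear X -> X}) (l m : R[i]).

Let cX : series_complete X := @complete_series_complete R X.

Lemma continuous_shift T l : continuous T -> continuous (shift T l).
Proof.
move=> cT x; apply: cvgB; first exact: cT.
by apply: cvgZl_tmp; exact: cvg_id.
Qed.

Lemma invertible_at_shift T l m :
  invertible_at (shift T l) m <-> invertible_at T (l + m).
Proof.
have E x : shift T l x - m *: x = T x - (l + m) *: x.
  by rewrite /shift scalerDl opprD addrA.
have E0 x : shift T l x = m *: x <-> T x = (l + m) *: x.
  by split=> H; apply: subr0_eq; [rewrite -E | rewrite E]; rewrite H subrr.
by split=> -[inj surj]; split=> [x /E0/inj//|y]; have [x <-] := surj y;
  exists x; rewrite E.
Qed.

Lemma invertible_Drazin S : invertible_at S 0 -> Drazin S.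
Proof.
move=> [inj surj]; split; apply/inf_nat_lty; exists 0%N; apply/seteqP; split.
- exact: null_incr.
- by move=> x Sx; apply: inj; rewrite scale0r.
- by move=> y _; have [x <-] := surj y; exists x; rewrite //= scale0r subr0.
- exact: range_decr.
Qed.

(** For l large compared with the norm of T, the perturbation series of the graph
    of T with m = 1 / l solves T w - l w = y. *)
Lemma invertible_far T : continuous T -> exists2 C : R, 0 < C &
  forall l, C <= nrm (l : R[i]^o) -> invertible_at T l.
Proof.
move=> cT; have [C C0 TC] := continuous_nrm cT.
exists (2 * C); first by rewrite mulr_gt0.
move=> l Cl; have l_gt0 : 0 < nrm (l : R[i]^o).
  by apply: lt_le_trans Cl; rewrite mulr_gt0.
have l0 : l != 0 by apply: contraTneq l_gt0 => ->; rewrite nrm0 ltxx.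
split=> [x Tx|y].
  apply: nrm_eq0; apply/eqP; rewrite eq_le nrm_ge0 andbT.
  have := TC x; rewrite Tx nrmZ => lx.
  have xl := ler_wpM2r (nrm_ge0 x) Cl; rewrite leNgt; apply/negP => x0.
  by have := mulr_gt0 C0 x0; lra.
pose G := [set p : X * X | T p.1 - p.2 = 0].
have sG : is_subspace G.
  split; first by rewrite /G /= linear0 subrr.
  move=> a [x u] [z v]; rewrite /G /= => /subr0_eq <- /subr0_eq <-.
  by rewrite linearP subrr.
have cG : closed G.
  apply: (closed_continuous_preimage (f := fun p : X * X => T p.1 - p.2))
    (@closed_null _ _ T 0 cT).
  move=> p; apply: cvgB; last exact: cvg_snd.
  by apply: (@continuous_comp _ _ _ fst T); [exact: cvg_fst | exact: cT].
have solve x : [set: X] x -> exists2 u, G (x, u) /\ [set: X] u & nrm u <= C * nrm x.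
  by move=> _; exists (T x) => //; split=> //; rewrite /G /= subrr.
have Cl' : C * nrm (l^-1 : R[i]^o) <= 1 / 2.
  have -> : nrm (l^-1 : R[i]^o) = (nrm (l : R[i]^o))^-1.
    apply: (mulfI (lt0r_neq0 l_gt0)); rewrite divff ?gt_eqF // -nrmZ.
    by rewrite /GRing.scale /= mulfV // nrm_real.
  rewrite ler_pdivrMr //; lra.
have [u Gu _] := perturbation cX sG cG solve (ltW C0) Cl' (x0 := - (l^-1 *: y)) I.
exists (- (l^-1 *: y) + l^-1 *: u); move/subr0_eq: Gu => /= ->.
rewrite scalerDr scalerN !scalerA mulfV // !scale1r.
by rewrite opprD opprK addrCA subrr addr0.
Qed.

(** What the argument needs of a class: it lies between the Drazin invertible
    operators and the operators with regular descent. *)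
Definition Drazin_like (P : (X -> X) -> Prop) :=
  (forall S, continuous S -> Drazin S -> P S) /\
  (forall S, continuous S -> P S -> exists d, regular_descent S d).

Definition resolvent_closure (T : X -> X) : set R[i]^o :=
  [set l | limit_of_invertible (shift T l)].

(** If l' in the set is near l, choose m with T - l' - m invertible and m smaller
    than the distance of l and l', so that l' + m differs from l. *)
Lemma closed_resolvent_closure T : closed (resolvent_closure T).
Proof.
apply: adherent_closed => l adl e e0.
have [l' Vl' ll'] := adl _ (divr_gt0 e0 (ltr0n _ 2 : 0 < 2)).
have [<-|l'_neq] := eqVneq l' l; first exact: Vl'.
have d0 : 0 < nrm (l' - l : R[i]^o) by rewrite nrm_gt0 // subr_eq0.
have [|m [m0 me inv]] := Vl' (Num.min (e / 2) (nrm (l' - l : R[i]^o))).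
  by rewrite lt_min d0 divr_gt0.
move: me; rewrite lt_min => /andP[me md].
exists (l' - l + m); split.
- apply/negP => /eqP lm0; move: md; rewrite -[m](addKr (l' - l)) lm0 addr0.
  by rewrite nrmN ltxx.
- apply: le_lt_trans (nrmD (l' - l : R[i]^o) m) _.
  by rewrite nrm_distC; move: ll' me; lra.
apply/invertible_at_shift; rewrite addrA [l + _]addrC subrK.
exact/invertible_at_shift.
Qed.

(** T - l - m is invertible for all 0 < |m| < e, so each point l' of the disc of
    radius e around l is approached by points of invertibility l' + t; the real
    number t > 0 is chosen to avoid l' + t = l and to stay within the disc. *)
Lemma nbhs_resolvent_closure T l : continuous T -> Drazin (shift T l) ->
  nbhs (l : R[i]^o) (resolvent_closure T).
Proof.
move=> cT /Drazin_ascent_descent[p [Dp _ _]].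
have [e e0 inv] := Drazin_punctured (@continuous_shift T l cT) Dp.
apply/nbhs_nrm; exists e => // l' ll' d d0.
set D := nrm (l - l' : R[i]^o) in ll'.
have [t [t0 td te tD]] : exists t : R,
    [/\ 0 < t, t < d, t < e - D & D != 0 -> t < D].
  have [D0|D0] := eqVneq D 0.
    exists (Num.min d (e - D) / 2); split=> //.
    - by rewrite divr_gt0 // lt_min d0 subr_gt0.
    - have : Num.min d (e - D) <= d by rewrite ge_min lexx.
      lra.
    - have : Num.min d (e - D) <= e - D by rewrite ge_min lexx orbT.
      lra.
  have D_gt0 : 0 < D by rewrite lt_neqAle eq_sym D0 nrm_ge0.
  exists (Num.min (Num.min d (e - D)) D / 2).
  set a := Num.min d _; set b := Num.min a D.
  have b0 : 0 < b by rewrite !lt_min d0 subr_gt0 ll'.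
  have ba : b <= a by rewrite ge_min lexx.
  have bD : b <= D by rewrite ge_min lexx orbT.
  have ad : a <= d by rewrite ge_min lexx.
  have ae : a <= e - D by rewrite ge_min lexx orbT.
  split; lra.
have tt : nrm (t%:C : R[i]^o) = t by rewrite nrm_real // ltW.
exists t%:C; split; last 2 first.
- by rewrite tt.
- apply/invertible_at_shift.
  have -> : l' + t%:C = l + (l' - l + t%:C) by rewrite addrA [l + _]addrC subrK.
  apply/invertible_at_shift; apply: inv.
    apply/negP => /eqP z0.
    have tE : t%:C = l - l' by rewrite -[LHS](addKr (l' - l)) z0 addr0 opprB.
    have DE : D = t by rewrite /D -tE tt.
    by have := tD; rewrite DE ltxx gt_eqF // => /(_ isT).
  apply: le_lt_trans (nrmD (l' - l : R[i]^o) t%:C) _.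
  by rewrite tt nrm_distC -/D; lra.
by rewrite (inj_eq (@complexI R) t 0) gt_eqF.
Qed.

Lemma spectrum_eq_Drazin P T : Drazin_like P -> continuous T ->
  connected (~` spectrum P T : set R[i]^o) -> spectrum P T = sigma_D T.
Proof.
move=> [DP Pr] cT conn; pose V := resolvent_closure T.
pose Omega : set R[i]^o := ~` spectrum P T.
have OmegaP l : Omega l <-> P (shift T l).
  by split=> [/contrapT//|Pl nPl]; exact: nPl.
have DrazinV l : Omega l -> V l -> Drazin (shift T l).
  move=> /OmegaP /(Pr (shift T l) (@continuous_shift T l cT))[d rd] Vl.
  exact: (Drazin_of_limit (@continuous_shift T l cT) rd Vl).
suff OmegaV : Omega `&` V = Omega.
  apply/seteqP; split=> l nP.
    by move=> Dl; apply: nP; apply: (DP (shift T l)) => //; exact: continuous_shift.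
  move=> Pl; apply: nP; have Ol : Omega l by apply/OmegaP.
  by apply: DrazinV => //; move: Ol; rewrite -OmegaV => -[].
apply: conn.
- have [C C0 far] := invertible_far cT.
  have farC (m : R[i]) : nrm (m : R[i]^o) < 1 -> invertible_at T ((C + 1)%:C + m).
    move=> m1; apply: far.
    have := nrm_le_dist ((C + 1)%:C : R[i]^o) (- m : R[i]).
    rewrite opprK nrmN nrm_real; first by lra.
    by rewrite addr_ge0 // ltW.
  exists (C + 1)%:C; split.
    apply/OmegaP; apply: (DP (shift T _)); first exact: continuous_shift.
    apply: invertible_Drazin; apply/invertible_at_shift; apply: farC.
    by rewrite nrm0.
  move=> e e0; pose t := Num.min e 1 / 2.
  have t0 : 0 < t by rewrite divr_gt0 // lt_min e0 ltr01.
  have te : t < e.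
    have : Num.min e 1 <= e by rewrite ge_min lexx.
    by rewrite /t; lra.
  have t1 : t < 1.
    have : Num.min e 1 <= 1 by rewrite ge_min lexx orbT.
    by rewrite /t; lra.
  exists t%:C; split; rewrite ?nrm_real ?(ltW t0) //.
    by rewrite (inj_eq (@complexI R) t 0) gt_eqF.
  by apply/invertible_at_shift/farC; rewrite nrm_real // ltW.
- exists V^°; first exact: open_interior.
  apply/seteqP; split=> l [Ol Vl]; split=> //; last exact: interior_subset Vl.
  by apply: nbhs_resolvent_closure => //; exact: DrazinV.
- by exists V => //; exact: closed_resolvent_closure.
Qed.

(** * The thirteen classes *)

Lemma Drazin_like_intro (P : (X -> X) -> Prop) :
  (forall S p, continuous S -> Drazin_index S p ->
     ascent S = (p%:R)%:E -> descent S = (p%:R)%:E -> P S) ->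
  (forall S, continuous S -> P S -> exists d, regular_descent S d) ->
  Drazin_like P.
Proof.
move=> DP Pr; split=> // S cS /Drazin_ascent_descent[p [Dp aS dS]].
exact: (DP S p).
Qed.

Lemma upper_semi_B_Fredholm_regular S : continuous S ->
  upper_semi_B_Fredholm S -> exists d, regular_descent S d.
Proof.
move=> cS [n [cR [/qdim_lty[m dimN] cSR]]].
apply: (finite_null_quotient_regular cS (p := n) (m := m)).
  exact/null_quotient_iso.
apply: closed_lifted_range => //; rewrite addn1 -image_range.
apply: (closed_in_closed cR) => //.
by rewrite image_range; exact: range_decr.
Qed.

Lemma lower_semi_B_Fredholm_regular S : continuous S ->
  lower_semi_B_Fredholm S -> exists d, regular_descent S d.
Proof.
move=> cS [n [_ /qdim_lty[m]]]; rewrite image_range.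
exact: finite_range_quotient_regular.
Qed.

Lemma fin_ess_descent_regular S : continuous S ->
  fin_ess_descent S -> exists d, regular_descent S d.
Proof.
move=> cS /inf_nat_lty[q /qdim_lty[m dimR]].
exact: finite_range_quotient_regular dimR.
Qed.

Lemma descent_regular S : continuous S ->
  (descent S < +oo)%E -> exists d, regular_descent S d.
Proof.
move=> cS /inf_nat_lty[q Rq].
apply: (finite_range_quotient_regular cS (q := q) (m := 0)).
by apply/has_dim_trivial => //; [rewrite Rq | exact: subspace_range].
Qed.

Lemma left_ess_Drazin_regular S : continuous S ->
  left_ess_Drazin S -> exists d, regular_descent S d.
Proof.
move=> cS [p [/inf_nat_finite/qdim_lty[m dimN] cR]].
apply: (finite_null_quotient_regular cS dimN).
by apply: closed_lifted_range => //; rewrite addn1.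
Qed.

Lemma left_Drazin_regular S : continuous S ->
  left_Drazin S -> exists d, regular_descent S d.
Proof.
move=> cS [p [/inf_nat_finite Np cR]].
apply: (finite_null_quotient_regular cS (p := p) (m := 0)).
  by apply/has_dim_trivial => //; [rewrite Np | exact: subspace_null].
by apply: closed_lifted_range => //; rewrite addn1.
Qed.

End ConnectedResolvent.

Lemma one_component_connected (Y : topologicalType) (A : set Y) :
  one_component A -> connected A.
Proof.
move=> [C imC]; have CE x : A x -> connected_component A x = C.
  by move=> Ax; have : [set C] (connected_component A x) by rewrite -imC; exists x.
have [x Ax _] : (connected_component A @` A) C by rewrite imC.
suff -> : A = connected_component A x by exact: component_connected.
apply/seteqP; split=> [y Ay|]; last exact: connected_component_sub.
rewrite (CE _ Ax) -(CE _ Ay); exact: connected_component_refl.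
Qed.

Theorem theorem4p3 (R : realType) (X : completeNormedModType R[i])
    (X_infinite : infinite_dimensional X)
    (T : {linear X -> X}) (T_bounded : bounded_near T (nbhs (0 : X)))
    (sigma : (X -> X) -> set R[i])
    (sigma_mem : [set @sigma_TUD R X; @sigma_qPhi R X; @sigma_Kt R X;
       @sigma_BPhi R X; @sigma_BW R X; @sigma_LDe R X; @sigma_BWp R X;
       @sigma_LD R X; @sigma_RDe R X; @sigma_BWm R X; @sigma_RD R X;
       @sigma_dsce R X; @sigma_dsc R X] sigma) :
  one_component (~` sigma T : set R[i]^o) -> sigma T = sigma_D T.
Proof.
have cT : continuous T by apply/linear_bounded_continuous.
move=> /one_component_connected.
have [P [DP ->]] : exists P : (X -> X) -> Prop, Drazin_like P /\ sigma = spectrum P.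
  case: sigma_mem => [[[[[[[[[[[[|]|]|]|]|]|]|]|]|]|]|]|] ->; eexists;
    (split; last by reflexivity); apply: Drazin_like_intro => S.
  - by move=> p cS Dp _ _; exact: Drazin_TUD Dp.
  - by move=> _; exact: TUD_regular.
  - by move=> p cS Dp _ _; exact: Drazin_quasi_Fredholm cS Dp.
  - exact: quasi_Fredholm_regular.
  - by move=> p cS Dp _ _; exact: Drazin_Kato_type cS Dp.
  - exact: Kato_type_regular.
  - by move=> p cS Dp _ _; exact: Drazin_B_Fredholm cS Dp.
  - move=> cS [n [cR [uS _]]].
    by apply: upper_semi_B_Fredholm_regular => //; exists n.
  - by move=> p cS Dp _ _; exact: Drazin_B_Weyl cS Dp.
  - move=> cS [[n [cR [uS _]]] _].
    by apply: upper_semi_B_Fredholm_regular => //; exists n.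
  - by move=> p cS Dp _ _; exact: Drazin_left_ess cS Dp.
  - exact: left_ess_Drazin_regular.
  - by move=> p cS Dp _ _; exact: Drazin_upper_semi_B_Weyl cS Dp.
  - by move=> cS [uS _]; exact: upper_semi_B_Fredholm_regular.
  - by move=> p cS Dp aS _; exact: Drazin_left cS Dp aS.
  - exact: left_Drazin_regular.
  - by move=> p cS Dp _ _; exact: Drazin_right_ess cS Dp.
  - move=> cS [q [qE _]]; apply: fin_ess_descent_regular => //.
    by rewrite /fin_ess_descent qE ltry.
  - by move=> p cS Dp _ _; exact: Drazin_lower_semi_B_Weyl cS Dp.
  - by move=> cS [lS _]; exact: lower_semi_B_Fredholm_regular.
  - by move=> p cS Dp _ dS; exact: Drazin_right cS Dp dS.
  - by move=> cS [q [qE _]]; apply: descent_regular; rewrite // qE ltry.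
  - by move=> p cS Dp _ _; exact: Drazin_fin_ess_descent Dp.
  - exact: fin_ess_descent_regular.
  - by move=> p cS Dp _ dS; exact: Drazin_fin_descent dS.
  - exact: descent_regular.
exact: spectrum_eq_Drazin.
Qed.
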